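(* Let $R$ be a commutative noetherian local ring of depth $t$, and let $n$ be an integer. Then $\mathsf{TF}_n(R)$ consists of totally reflexive modules (i.e. $\mathsf{TF}_n(R)$ coincides with the subcategory of totally reflexive $R$-modules) if at least one of the following holds. (1) $n\ge t+2$, and the subcategory $\mathsf{TF}_n(R)$ is closed under syzygies. (2) $n\ge t+1$, and the subcategory $\mathsf{TF}_n(R)$ is closed under extensions. (3) $n\ge1$, and $\mathsf{TF}_n(R)=\mathsf{TF}_{n+1}(R)$.
   Context: All modules are finitely generated, $\operatorname{mod}R$ is the category of finitely generated $R$-modules, and subcategories are strictly full (full and closed under isomorphism). For a projective presentation $P_1\xrightarrow{d}P_0\to M\to0$ with $P_0,P_1$ finitely generated projective, $\operatorname{Tr}M=\operatorname{Coker}(d^\ast)$ where $(-)^\ast=\operatorname{Hom}_R(-,R)$; $\Omega M$ is the kernel of a surjection from a finitely generated projective module onto $M$. Both are unique up to projective summands. $\mathsf{TF}_n(R)$ is the subcategory of $n$-torsionfree modules, i.e. modules $M$ with $\operatorname{Ext}_R^i(\operatorname{Tr}M,R)=0$ for all $1\le i\le n$. A module $M$ is totally reflexive if $\operatorname{Ext}_R^i(M,R)=0=\operatorname{Ext}_R^i(\operatorname{Tr}M,R)$ for all $i\ge1$. A subcategory $\mathcal X$ is closed under syzygies if $\Omega M\in\mathcal X$ for all $M\in\mathcal X$, and closed under extensions if for each exact sequence $0\to L\to M\to N\to0$ in $\operatorname{mod}R$ with $L,N\in\mathcal X$ one has $M\in\mathcal X$. *)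

(* Defs.v *)
From HB Require Import structures.
From mathcomp Require Import all_boot all_order all_algebra.
From mathcomp Require Import boolp classical_sets.

Set Implicit Arguments.
Unset Strict Implicit.
Unset Printing Implicit Defensive.

Import Order.TTheory GRing.Theory Num.Theory.
Local Open Scope ring_scope.

(* {linear U -> V} carries no module structure in MathComp; [lin_hom U V] is
   that type seen as the R-module Hom_R(U, V), for R commutative. *)
Definition lin_hom (R : comNzRingType) (U V : lmodType R) : Type :=
  {linear U -> V}.

Section HomModule.
Variables (R : comNzRingType) (U V : lmodType R).

HB.instance Definition _ := gen_eqMixin (lin_hom U V).
HB.instance Definition _ := gen_choiceMixin (lin_hom U V).

Lemma hom_ext (f g : lin_hom U V) : f =1 g -> f = g.
Proof.
case: f g => [f [[Df] [Zf]]] [g [[Dg] [Zg]]] /= /funext fg.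
case: _ / fg in Dg Zg *.
by rewrite (Prop_irrelevance Df Dg) (Prop_irrelevance Zf Zg).
Qed.

Definition hom_zero : lin_hom U V := (\0 : U -> V) : {linear U -> V}.
Definition hom_opp (f : lin_hom U V) : lin_hom U V := (\- f) : {linear U -> V}.
Definition hom_add (f g : lin_hom U V) : lin_hom U V := (f \+ g) : {linear U -> V}.
Definition hom_scale (a : R) (f : lin_hom U V) : lin_hom U V :=
  (a \*: f) : {linear U -> V}.

Fact hom_addA : associative hom_add.
Proof. by move=> f g h; apply: hom_ext => x /=; rewrite addrA. Qed.
Fact hom_addC : commutative hom_add.
Proof. by move=> f g; apply: hom_ext => x /=; rewrite addrC. Qed.
Fact hom_add0 : left_id hom_zero hom_add.
Proof. by move=> f; apply: hom_ext => x /=; rewrite add0r. Qed.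
Fact hom_addN : left_inverse hom_zero hom_opp hom_add.
Proof. by move=> f; apply: hom_ext => x /=; rewrite addNr. Qed.

HB.instance Definition _ :=
  GRing.isZmodule.Build (lin_hom U V) hom_addA hom_addC hom_add0 hom_addN.

Fact hom_scaleA (a b : R) (f : lin_hom U V) :
  hom_scale a (hom_scale b f) = hom_scale (a * b) f.
Proof. by apply: hom_ext => x /=; rewrite scalerA. Qed.
Fact hom_scale1 : left_id 1 hom_scale.
Proof. by move=> f; apply: hom_ext => x /=; rewrite scale1r. Qed.
Fact hom_scaleDr : right_distributive hom_scale +%R.
Proof. by move=> a f g; apply: hom_ext => x /=; rewrite scalerDr. Qed.
Fact hom_scaleDl (f : lin_hom U V) : {morph hom_scale^~ f : a b / a + b}.
Proof. by move=> a b; apply: hom_ext => x /=; rewrite scalerDl. Qed.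

HB.instance Definition _ := GRing.Zmodule_isLmodule.Build R (lin_hom U V)
  hom_scaleA hom_scale1 hom_scaleDr hom_scaleDl.

End HomModule.

(* Hom_R(d, N) : Hom_R(V, N) -> Hom_R(U, N) *)
Definition hom_precomp (R : comNzRingType) (U V : lmodType R)
    (d : {linear U -> V}) (N : lmodType R) (f : lin_hom V N) : lin_hom U N :=
  (f \o d) : {linear U -> N}.

Fact hom_precomp_is_linear (R : comNzRingType) (U V : lmodType R)
  (d : {linear U -> V}) (N : lmodType R) : linear (@hom_precomp R U V d N).
Proof. by move=> a f g; apply: hom_ext. Qed.

HB.instance Definition _ (R : comNzRingType) (U V : lmodType R)
    (d : {linear U -> V}) (N : lmodType R) :=
  GRing.isLinear.Build R (lin_hom V N) (lin_hom U N) _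
    (@hom_precomp R U V d N) (@hom_precomp_is_linear R U V d N).

Definition dual (R : comNzRingType) (M : lmodType R) : lmodType R :=
  lin_hom M R^o.

Section Modules.
Variable R : comNzRingType.

Definition surjective (A B : Type) (f : A -> B) : Prop :=
  forall y, exists x, f x = y.

Definition exact_at (U V W : lmodType R) (f : {linear U -> V})
    (g : {linear V -> W}) : Prop :=
  forall y : V, g y = 0 <-> exists x : U, f x = y.

Definition short_exact (L M N : lmodType R) (f : {linear L -> M})
    (g : {linear M -> N}) : Prop :=
  [/\ injective f, exact_at f g & surjective g].

Definition fin_gen (M : lmodType R) : Prop :=
  exists (k : nat) (e : 'I_k -> M), forall x : M,
    exists c : 'I_k -> R, x = \sum_i c i *: e i.

Definition projective (P : lmodType R) : Prop :=
  forall (M N : lmodType R) (g : {linear M -> N}) (f : {linear P -> N}),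
    surjective g -> exists h : {linear P -> M}, g \o h =1 f.

Record proj_resolution (M : lmodType R) := ProjResolution {
  res_obj : nat -> lmodType R;
  res_diff : forall i, {linear res_obj i.+1 -> res_obj i};
  res_aug : {linear res_obj 0 -> M};
  res_proj : forall i, projective (res_obj i);
  res_exact : forall i, exact_at (res_diff i.+1) (res_diff i);
  res_exact0 : exact_at (res_diff 0) res_aug;
  res_surj : surjective res_aug
}.

(* Ext_R^i(M, N) = 0, as the vanishing of the i-th cohomology of
   0 -> Hom(P_0, N) -> Hom(P_1, N) -> ... for a projective resolution P of M;
   this does not depend on P. *)
Definition Ext_eq0 (i : nat) (M N : lmodType R) : Prop :=
  exists P : proj_resolution M,
    match i with
    | 0 => injective (@hom_precomp R _ _ (res_diff P 0) N)
    | j.+1 => exact_at (@hom_precomp R _ _ (res_diff P j) N)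
                       (@hom_precomp R _ _ (res_diff P j.+1) N)
    end.

(* T is a transpose of M: T = Coker (d^* : P_0^* -> P_1^* ) for a presentation
   P_1 -d-> P_0 -> M -> 0 by finitely generated projective modules. *)
Definition is_transpose (M T : lmodType R) : Prop :=
  exists (P1 P0 : lmodType R) (d : {linear P1 -> P0}) (p : {linear P0 -> M})
         (q : {linear dual P1 -> T}),
    [/\ fin_gen P1 /\ projective P1,
        fin_gen P0 /\ projective P0,
        exact_at d p /\ surjective p,
        exact_at (@hom_precomp R _ _ d R^o) q
      & surjective q].

Definition is_syzygy (M K : lmodType R) : Prop :=
  exists (P : lmodType R) (i : {linear K -> P}) (p : {linear P -> M}),
    [/\ fin_gen P, projective P & short_exact i p].

Definition TF (n : int) (M : lmodType R) : Prop :=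
  fin_gen M /\
  exists2 T : lmodType R, is_transpose M T &
    forall i : nat, (1 <= i)%N -> i%:Z <= n -> Ext_eq0 i T R^o.

Definition totally_reflexive (M : lmodType R) : Prop :=
  [/\ fin_gen M,
      forall i : nat, (1 <= i)%N -> Ext_eq0 i M R^o
    & exists2 T : lmodType R, is_transpose M T &
        forall i : nat, (1 <= i)%N -> Ext_eq0 i T R^o].

Definition closed_under_syzygies (X : lmodType R -> Prop) : Prop :=
  forall M K : lmodType R, X M -> is_syzygy M K -> X K.

Definition closed_under_extensions (X : lmodType R -> Prop) : Prop :=
  forall (L M N : lmodType R) (f : {linear L -> M}) (g : {linear M -> N}),
    fin_gen L -> fin_gen M -> fin_gen N -> short_exact f g ->
    X L -> X N -> X M.

End Modules.

Section Rings.
Variable R : comNzRingType.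

(* Unlike the boolean [idealr] of MathComp, these are arbitrary subsets and may
   be the whole ring. *)
Definition ideal (I : set R) : Prop :=
  [/\ I 0, forall a b, I a -> I b -> I (a + b) & forall r a, I a -> I (r * a)].

Definition ideal_gen (s : seq R) : set R :=
  [set a | exists c : nat -> R, a = \sum_(i < size s) c i * s`_i].

Definition noetherian : Prop :=
  forall I : set R, ideal I -> exists s : seq R, I = ideal_gen s.

Definition maximal_ideal (m : set R) : Prop :=
  [/\ ideal m, ~ m 1
    & forall J : set R, ideal J -> ~ J 1 -> (m `<=` J)%classic -> J = m].

(* (R, m) is a local ring *)
Definition is_local (m : set R) : Prop :=
  maximal_ideal m /\ forall m' : set R, maximal_ideal m' -> m' = m.

(* s_i is a nonzerodivisor on R / (s_0, ..., s_(i-1)) for all i, and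
   R / (s) is nonzero *)
Definition regular_seq (s : seq R) : Prop :=
  (forall i a, (i < size s)%N ->
     ideal_gen (take i s) (s`_i * a) -> ideal_gen (take i s) a) /\
  ~ ideal_gen s 1.

(* depth of the local ring (R, m): the maximal length of a regular sequence
   in m *)
Definition has_depth (m : set R) (t : nat) : Prop :=
  (exists s : seq R, [/\ {in s, forall x, m x}, regular_seq s & size s = t]) /\
  (forall s : seq R,
     {in s, forall x, m x} -> regular_seq s -> (size s <= t)%N).

End Rings.

(* Main.v *)
Require Import Defs.
From HB Require Import structures.
From mathcomp Require Import all_boot all_order all_algebra.
From mathcomp Require Import boolp classical_sets.
Import Order.TTheory GRing.Theory Num.Theory.
Local Open Scope ring_scope.

(** Write Y_n for the class of finitely generated modules Y such that
    Ext^i(Y, R) = 0 for 1 <= i <= n. A module is n-torsionfree exactly when its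
    transpose lies in Y_n, whichever transpose is taken, and the transpose of
    the transpose is the module itself up to projective summands. A totally
    reflexive module is visibly n-torsionfree, so only the other inclusion is at
    stake.

    Suppose that every n-torsionfree M satisfies Ext^i(M, R) = 0 for all i > 0.
    Then its transpose T is n-torsionfree too, because M is a transpose of T and
    lies in Y_n; the same vanishing applied to T says that M is totally
    reflexive. If merely Ext^1(M, R) = 0 for all n-torsionfree M, then the
    syzygy of M is again n-torsionfree and all Ext^i(M, R) vanish by dimension
    shifting ([TF_totally_reflexive]). So under each of the first two
    assumptions it is enough to kill E = Ext^1(M, R).

    Let G be a resolution of M by finitely generated free modules, Y the
    cokernel of G_0^* -> G_1^*, a transpose of M, and Z the image of
    G_1^* -> G_2^*. There is an exact sequence 0 -> E -> Y -> Z -> 0, and every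
    functional on Y kills E. If Ext^i(Y, R) and Ext^i(Z, R) vanish up to degrees
    t and t + 1, then E = 0 ([depth_detects]): modulo a maximal regular sequence
    s the functionals Y -> R/(s) still come from functionals Y -> R, hence kill
    E, while every functional E -> R/(s) extends to Y; but a nonzero finitely
    generated E has a nonzero functional into R/(s), since the residue field
    embeds in R/(s). As to the vanishing for Z: if the syzygy of M is
    n-torsionfree, then the cokernel of G_1^* -> G_2^* is its transpose, and Z is
    the first syzygy of that cokernel, so that one degree is lost. If TF_n is
    closed under extensions, then it contains the universal extension
    0 -> L -> X -> M -> 0 of M by a free module L mapping onto Ext^1(M, R), and
    Z itself is a transpose of X ([universal_extension]).

    The third assumption says Y_n = Y_(n+1), whence Ext^i(Y, R) = 0 for all
    i > 0 and Y in Y_n ([Ext_vanish_stable]). If M is n-torsionfree with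
    transpose T, the dual of a resolution of T is therefore exact in positive
    degrees and coresolves M by projectives. Its n-th cosyzygy C lies in Y_n,
    hence has no Ext into R in positive degrees, and neither has M, which is an
    n-th syzygy of C. *)

Set Implicit Arguments.
Unset Strict Implicit.
Unset Printing Implicit Defensive.

(** * Linear maps, kernels and quotients *)

Section LinearMaps.
Variable R : comNzRingType.
Implicit Types U V W P : lmodType R.

Lemma linear_fun U V (f : U -> V) :
  linear f -> exists g : {linear U -> V}, g =1 f.
Proof.
move=> lin_f; pose m := GRing.isLinear.Build R U V _ f lin_f.
by pose g : {linear U -> V} := HB.pack f m; exists g.
Qed.

Lemma factor_surj U V W (q : {linear U -> V}) (f : {linear U -> W}) :
    surjective q -> (forall x, q x = 0 -> f x = 0) ->
  exists g : {linear V -> W}, forall x, g (q x) = f x.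
Proof.
move=> /choice[r rK] ker_qf.
have fE x y : q x = q y -> f x = f y.
  move=> qxy; apply/eqP; rewrite -subr_eq0 -linearB; apply/eqP/ker_qf.
  by rewrite linearB qxy subrr.
have [|g gE] := @linear_fun V W (f \o r).
  by move=> a x y /=; rewrite -linearP; apply: fE; rewrite linearP !rK.
by exists g => x; rewrite gE /=; apply: fE; rewrite rK.
Qed.

Lemma factor_inj U V W (i : {linear U -> V}) (f : {linear W -> V}) :
    injective i -> (forall x, exists y, i y = f x) ->
  exists g : {linear W -> U}, forall x, i (g x) = f x.
Proof.
move=> i_inj /choice[r rE].
have [|g gE] := @linear_fun W U r.
  by move=> a x y; apply: i_inj; rewrite linearP !rE linearP.
by exists g => x; rewrite gE.
Qed.

Definition ker_pred U V (f : {linear U -> V}) : {pred U} := fun x => f x == 0.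

Fact ker_submod U V (f : {linear U -> V}) : submod_closed (ker_pred f).
Proof.
split=> [|a x y]; rewrite !unfold_in ?linear0 // => /eqP fx /eqP fy.
by rewrite linearP fx fy scaler0 addr0.
Qed.

HB.instance Definition _ U V (f : {linear U -> V}) :=
  GRing.isSubmodClosed.Build R U (ker_pred f) (ker_submod f).

Record kernel U V (f : {linear U -> V}) : Type :=
  Kernel { kernel_val : U; _ : ker_pred f kernel_val }.

HB.instance Definition _ U V (f : {linear U -> V}) :=
  [isSub for @kernel_val U V f].
HB.instance Definition _ U V (f : {linear U -> V}) :=
  [Choice of kernel f by <:].
HB.instance Definition _ U V (f : {linear U -> V}) :=
  [SubChoice_isSubLmodule of kernel f by <:].

Definition kernel_incl U V (f : {linear U -> V}) : {linear kernel f -> U} :=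
  (val : kernel f -> U).

Lemma kernel_inclK U V (f : {linear U -> V}) (x : kernel f) :
  f (kernel_incl f x) = 0.
Proof. by apply/eqP; exact: (valP x). Qed.

Lemma kernel_lift U V (f : {linear U -> V}) x :
  f x = 0 -> exists y : kernel f, kernel_incl f y = x.
Proof.
move=> fx; have kx : ker_pred f x by apply/eqP.
by exists (Kernel kx).
Qed.

Lemma kernel_incl_inj U V (f : {linear U -> V}) : injective (kernel_incl f).
Proof. exact: val_inj. Qed.

Lemma kernel_exact U V (f : {linear U -> V}) : exact_at (kernel_incl f) f.
Proof.
move=> x; split=> [/kernel_lift // | [y <-]]; exact: kernel_inclK.
Qed.

Lemma proj_lift P U V W (g : {linear U -> V}) (h : {linear V -> W})
    (f : {linear P -> V}) :
    projective P -> exact_at g h -> (forall x, h (f x) = 0) ->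
  exists l : {linear P -> U}, forall x, g (l x) = f x.
Proof.
move=> projP gh hf.
have [|g' g'E] := factor_inj (f := g) (@kernel_incl_inj _ _ h).
  by move=> x; apply: kernel_lift; apply/gh; exists x.
have [|f' f'E] := factor_inj (f := f) (@kernel_incl_inj _ _ h).
  by move=> x; apply: kernel_lift.
have [|l lE] := projP _ _ g' f'.
  move=> y; have [x gx] := (gh _).1 (kernel_inclK y).
  by exists x; apply: kernel_incl_inj; rewrite g'E.
by exists l => x; rewrite -g'E -f'E -lE.
Qed.

Lemma proj_lift_surj P U V (g : {linear U -> V}) (f : {linear P -> V}) :
    projective P -> surjective g ->
  exists l : {linear P -> U}, forall x, g (l x) = f x.
Proof. by move=> projP /(projP _ _ _ f). Qed.

End LinearMaps.

Section Quotients.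
Variables (R : comNzRingType) (V : lmodType R).

Record submodule := Submodule {
  smod_set :> V -> Prop;
  smod0 : smod_set 0;
  smodD : forall x y, smod_set x -> smod_set y -> smod_set (x + y);
  smodZ : forall a x, smod_set x -> smod_set (a *: x)
}.

Variable S : submodule.

Lemma smodN x : S x -> S (- x).
Proof. by rewrite -scaleN1r; apply: smodZ. Qed.

Lemma smodB x y : S x -> S y -> S (x - y).
Proof. by move=> Sx /smodN; apply: smodD. Qed.

Lemma smodC x y : S (x - y) -> S (y - x).
Proof. by rewrite -opprB => /smodN; rewrite opprK. Qed.

Definition quot_repr (x : V) : V := choose (fun y => `[< S (y - x) >]) x.

Lemma quot_reprP x : S (quot_repr x - x).
Proof.
apply/asboolP; apply: (@chooseP _ (fun y => `[< S (y - x) >]) x).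
by apply/asboolP; rewrite subrr; apply: smod0.
Qed.

Lemma eq_quot_repr x y : S (x - y) -> quot_repr x = quot_repr y.
Proof.
move=> Sxy; rewrite /quot_repr.
have E : (fun z => `[< S (z - x) >]) =1 (fun z => `[< S (z - y) >]).
  move=> z; apply: asbool_equiv_eq; split=> Sz.
    by rewrite -(subrKA x); apply: smodD.
  by rewrite -(subrKA y); apply: smodD => //; apply: smodC.
rewrite (eq_choose E); apply: choose_id; apply/asboolP => //.
by rewrite subrr; apply: smod0.
Qed.

(** Elements are the chosen representatives of the cosets. *)
Record quot : Type := Quot { quot_val : V; _ : quot_repr quot_val == quot_val }.
HB.instance Definition _ := [isSub for quot_val].
HB.instance Definition _ := [Choice of quot by <:].

Fact quot_pi_subproof x : quot_repr (quot_repr x) == quot_repr x.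
Proof. by apply/eqP/eq_quot_repr/quot_reprP. Qed.

Definition quot_pi (x : V) : quot := Quot (quot_pi_subproof x).

Lemma quot_piP x : S (val (quot_pi x) - x).
Proof. exact: quot_reprP. Qed.

Lemma eq_quot_pi x y : S (x - y) -> quot_pi x = quot_pi y.
Proof. by move=> Sxy; apply/val_inj/eq_quot_repr. Qed.

Lemma quot_valK : cancel val quot_pi.
Proof. by move=> x; apply/val_inj/eqP/(valP x). Qed.

Definition quot_add (a b : quot) := quot_pi (val a + val b).
Definition quot_opp (a : quot) := quot_pi (- val a).
Definition quot_scale (r : R) (a : quot) := quot_pi (r *: val a).

Lemma quot_piD x y : quot_add (quot_pi x) (quot_pi y) = quot_pi (x + y).
Proof.
by apply: eq_quot_pi; rewrite opprD addrACA; apply: smodD; apply: quot_piP.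
Qed.

Lemma quot_piN x : quot_opp (quot_pi x) = quot_pi (- x).
Proof. by apply: eq_quot_pi; rewrite -opprD; apply/smodN/quot_piP. Qed.

Lemma quot_piZ r x : quot_scale r (quot_pi x) = quot_pi (r *: x).
Proof. by apply: eq_quot_pi; rewrite -scalerBr; apply/smodZ/quot_piP. Qed.

Lemma quot_ind (P : quot -> Prop) : (forall x, P (quot_pi x)) -> forall a, P a.
Proof. by move=> Ppi a; rewrite -(quot_valK a). Qed.

Fact quot_addA : associative quot_add.
Proof.
by elim/quot_ind=> x; elim/quot_ind=> y; elim/quot_ind=> z;
  rewrite !quot_piD addrA.
Qed.

Fact quot_addC : commutative quot_add.
Proof. by move=> a b; rewrite /quot_add addrC. Qed.

Fact quot_add0 : left_id (quot_pi 0) quot_add.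
Proof. by elim/quot_ind=> x; rewrite quot_piD add0r. Qed.

Fact quot_addN : left_inverse (quot_pi 0) quot_opp quot_add.
Proof. by elim/quot_ind=> x; rewrite quot_piN quot_piD addNr. Qed.

HB.instance Definition _ :=
  GRing.isZmodule.Build quot quot_addA quot_addC quot_add0 quot_addN.

Fact quot_scaleA a b x : quot_scale a (quot_scale b x) = quot_scale (a * b) x.
Proof. by elim/quot_ind: x => x; rewrite !quot_piZ scalerA. Qed.

Fact quot_scale1 : left_id 1 quot_scale.
Proof. by elim/quot_ind=> x; rewrite quot_piZ scale1r. Qed.

Fact quot_scaleDr : right_distributive quot_scale +%R.
Proof.
move=> a; elim/quot_ind=> x; elim/quot_ind=> y.
transitivity (quot_scale a (quot_pi (x + y))); first by rewrite -quot_piD.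
by rewrite !quot_piZ scalerDr -quot_piD.
Qed.

Fact quot_scaleDl x : {morph quot_scale^~ x : a b / a + b}.
Proof.
move=> a b; elim/quot_ind: x => x.
by rewrite !quot_piZ scalerDl -quot_piD.
Qed.

HB.instance Definition _ := GRing.Zmodule_isLmodule.Build R quot
  quot_scaleA quot_scale1 quot_scaleDr quot_scaleDl.

Fact quot_pi_linear : linear quot_pi.
Proof.
by move=> a x y; rewrite -quot_piD -quot_piZ.
Qed.

HB.instance Definition _ :=
  GRing.isLinear.Build R V quot _ quot_pi quot_pi_linear.

Definition quot_proj : {linear V -> quot} := quot_pi.

Lemma quot_proj_surj : surjective quot_proj.
Proof. by move=> y; exists (val y); apply: quot_valK. Qed.

Lemma quot_proj_eq0 x : quot_proj x = 0 <-> S x.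
Proof.
split=> [px0 | Sx]; last first.
  by rewrite -[RHS](linear0 quot_proj); apply: eq_quot_pi; rewrite subr0.
have := quot_piP x; rewrite (_ : quot_pi x = quot_pi 0) //.
by move=> /(smodB (quot_piP 0)); rewrite subr0 opprB addrCA subrr addr0.
Qed.

End Quotients.

Section Images.
Variables (R : comNzRingType) (U V : lmodType R).

Definition image_smod (f : {linear U -> V}) : submodule V.
Proof.
exists (fun y => exists x, f x = y).
- by exists 0; apply: linear0.
- by move=> _ _ [x <-] [y <-]; exists (x + y); apply: linearD.
- by move=> a _ [x <-]; exists (a *: x); apply: linearZ.
Defined.

Definition kernel_smod (f : {linear U -> V}) : submodule U.
Proof.
exists (fun x => f x = 0).
- exact: linear0.
- by move=> x y fx fy; rewrite linearD fx fy addr0.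
- by move=> a x fx; rewrite linearZ /= fx scaler0.
Defined.

Lemma coker_exact (f : {linear U -> V}) :
  exact_at f (quot_proj (image_smod f)).
Proof. by move=> y; apply: quot_proj_eq0. Qed.

End Images.

(** * Finitely generated modules over a noetherian ring *)

Section FinGen.
Variable R : comNzRingType.
Implicit Types U V W M P : lmodType R.

Definition row_map M k (e : 'I_k -> M) (r : 'rV[R]_k) : M :=
  \sum_i r 0 i *: e i.

Fact row_map_linear M k (e : 'I_k -> M) : linear (row_map e).
Proof.
move=> a x y; rewrite /row_map scaler_sumr -big_split /=.
by apply: eq_bigr => i _; rewrite !mxE scalerDl scalerA.
Qed.

HB.instance Definition _ M k (e : 'I_k -> M) :=
  GRing.isLinear.Build R 'rV[R]_k M _ (row_map e) (row_map_linear e).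

Lemma row_map_delta M k (e : 'I_k -> M) i : row_map e (delta_mx 0 i) = e i.
Proof.
rewrite /row_map (bigD1 i) //= big1 => [|j ji]; rewrite !mxE !eqxx /=.
  by rewrite scale1r addr0.
by rewrite (negbTE ji) scale0r.
Qed.

Lemma row_eq_on_basis M k (f g : {linear 'rV[R]_k -> M}) :
  (forall i, f (delta_mx 0 i) = g (delta_mx 0 i)) -> f =1 g.
Proof.
move=> fg x; rewrite (row_sum_delta x) !linear_sum /=.
by apply: eq_bigr => i _; rewrite !linearZ /= fg.
Qed.

Lemma free_projective k : projective 'rV[R]_k.
Proof.
move=> M N g f /choice[s gs].
exists (row_map (fun i => s (f (delta_mx 0 i))) : {linear _ -> _}).
apply: (@row_eq_on_basis _ _ (g \o row_map _ : {linear _ -> _}) f) => i /=.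
by rewrite row_map_delta gs.
Qed.

Lemma free_fin_gen k : fin_gen 'rV[R]_k.
Proof.
exists k, (fun i => delta_mx 0 i) => x; exists (fun i => x 0 i).
exact: row_sum_delta.
Qed.

Lemma fin_gen_cover M : fin_gen M ->
  exists k (f : {linear 'rV[R]_k -> M}), surjective f.
Proof.
move=> [k [e eP]]; exists k, (row_map e : {linear _ -> _}) => x.
have [c ->] := eP x; exists (\row_i c i).
by apply: eq_bigr => i _; rewrite mxE.
Qed.

Lemma fin_gen_surj U V (f : {linear U -> V}) :
  surjective f -> fin_gen U -> fin_gen V.
Proof.
move=> f_surj [k [e eP]]; exists k, (f \o e) => y.
have [x <-] := f_surj y; have [c ->] := eP x; exists c.
by rewrite linear_sum; apply: eq_bigr => i _; rewrite linearZ.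
Qed.

(** Subtracting off one generator at a time suits induction on the list better
    than an indexed sum; [spanP] relates the two. *)
Fixpoint in_span M (s : seq M) (x : M) : Prop :=
  if s is y :: s' then exists a : R, in_span s' (x - a *: y) else x = 0.

Lemma span0 M (s : seq M) : in_span s 0.
Proof. by elim: s => //= y s IH; exists 0; rewrite scale0r subr0. Qed.

Lemma spanD M (s : seq M) x y : in_span s x -> in_span s y -> in_span s (x + y).
Proof.
elim: s x y => [|z s IH] x y /=; first by move=> -> ->; rewrite addr0.
move=> [a sx] [b sy]; exists (a + b).
by rewrite scalerDl opprD addrACA; apply: IH.
Qed.

Lemma spanZ M (s : seq M) a x : in_span s x -> in_span s (a *: x).
Proof.
elim: s x => [|z s IH] x /=; first by move=> ->; rewrite scaler0.
by move=> [b sx]; exists (a * b); rewrite -scalerA -scalerBr; apply: IH.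
Qed.

Lemma span_cat M (s s' : seq M) x y :
  in_span s x -> in_span s' y -> in_span (s ++ s') (x + y).
Proof.
elim: s x => [|z s IH] x /=; first by move=> ->; rewrite add0r.
by move=> [a sx] s'y; exists a; rewrite addrAC; apply: IH.
Qed.

Lemma spanP M (s : seq M) x : in_span s x <->
  exists c : nat -> R, x = \sum_(i < size s) c i *: s`_i.
Proof.
split=> [|[c ->]].
  elim: s x => [|y s IH] x /=; first by exists (fun=> 0); rewrite big_ord0.
  move=> [a /IH[c xE]]; exists (fun i => if i is j.+1 then c j else a).
  by rewrite big_ord_recl /= -xE addrC subrK.
elim: s c => [|y s IH] c; first by rewrite big_ord0.
exists (c 0%N); rewrite big_ord_recl /= addrC addKr.
exact: IH (fun i => c i.+1).
Qed.

Lemma fin_genP M : fin_gen M <-> exists s : seq M, forall x, in_span s x.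
Proof.
split=> [[k [e eP]] | [s sP]]; last first.
  exists (size s), (fun i => s`_i) => x.
  by have [c ->] := (spanP _ _).1 (sP x); exists (fun i => c i).
exists (codom e) => x; have [c ->] := eP x; apply/spanP.
case: k e eP c => [|k] e eP c.
  by exists (fun=> 0); rewrite codomE enum_ord0 !big_ord0.
exists (fun i => c (inord i)); rewrite size_codom card_ord.
apply: eq_bigr => i _; rewrite inord_val; congr (_ *: _).
rewrite codomE (nth_map ord0) ?size_enum_ord //.
by congr (e _); apply: val_inj; rewrite /= nth_enum_ord.
Qed.

Lemma span_map U V (f : {linear U -> V}) s x :
  injective f -> in_span (map f s) (f x) -> in_span s x.
Proof.
move=> f_inj; elim: s x => [|y s IH] x /=.
  by move=> fx; apply: f_inj; rewrite fx linear0.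
by move=> [a h]; exists a; apply: IH; rewrite linearB linearZ.
Qed.

Lemma ideal_genE (s : seq R) a : ideal_gen s a <-> in_span (s : seq R^o) a.
Proof. exact: iff_sym (spanP (s : seq R^o) a). Qed.

Lemma mem_ideal_gen (s : seq R) b : b \in s -> ideal_gen s b.
Proof.
move=> /(nthP 0)[i il <-]; exists (fun j => (j == i)%:R).
rewrite (bigD1 (Ordinal il)) //= eqxx mul1r big1 ?addr0 // => j.
by rewrite -val_eqE /= => /negbTE->; rewrite mul0r.
Qed.

Hypothesis R_noetherian : noetherian R.

(** The leading coefficients, along the head of the list, of the elements of
    the submodule form an ideal; generators of that ideal lift to the
    submodule, and what they leave over is spanned by the tail. *)
Lemma noetherian_span M (S : submodule M) (s : seq M) :
    (forall x, S x -> in_span s x) ->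
  exists g : seq M, (forall y, y \in g -> S y) /\ (forall x, S x -> in_span g x).
Proof.
elim: s S => [|z s IH] S sS; first by exists [::].
pose I a := exists y, in_span s y /\ S (a *: z + y).
have idI : ideal (I : set R).
  split.
  - by exists 0; rewrite scale0r addr0; split; [exact: span0 | exact: smod0].
  - move=> a b [y [sy Sy]] [w [sw Sw]]; exists (y + w).
    by rewrite scalerDl addrACA; split; [exact: spanD | exact: smodD].
  - move=> r a [y [sy Sy]]; exists (r *: y).
    by rewrite -scalerA -scalerDr; split; [exact: spanZ | exact: smodZ].
have [l lE] := R_noetherian idI.
have lI b : b \in l -> I b by move=> /mem_ideal_gen; rewrite -lE.
have [g [gS gP]] : exists g : seq M, (forall y, y \in g -> S y) /\
    forall a, in_span (l : seq R^o) a ->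
      exists w, in_span g w /\ in_span s (w - a *: z).
  elim: l lI {lE} => [|b l IHl] lI.
    exists [::]; split=> // a /= ->; exists 0; split=> //.
    by rewrite scale0r subr0; apply: span0.
  have [|g [gS gP]] := IHl; first by move=> c cl; apply: lI; rewrite inE cl orbT.
  have [|y [sy Sy]] := lI b; first by rewrite inE eqxx.
  exists (b *: z + y :: g); split=> [x|a [c /gP[w [gw sw]]]].
    by rewrite inE => /orP[/eqP-> // | /gS].
  exists (w + c *: (b *: z + y)); split; first by exists c; rewrite addrK.
  have -> : w + c *: (b *: z + y) - a *: z =
      w - ((a : R) - c * b) *: z + c *: y.
    by rewrite scalerDr scalerA scalerBl opprB !addrA [LHS]addrAC.
  by apply: spanD => //; apply: spanZ.
have [S' S'E] : exists S' : submodule M, forall x, S' x <-> S x /\ in_span s x.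
  unshelve eexists; first exists (fun x => S x /\ in_span s x).
  - by split; [exact: smod0 | exact: span0].
  - by move=> x y [Sx sx] [Sy sy]; split; [exact: smodD | exact: spanD].
  - by move=> a x [Sx sx]; split; [exact: smodZ | exact: spanZ].
  - by [].
have [|g' [g'S g'P]] := IH S'; first by move=> x /S'E[].
exists (g ++ g'); split=> [y | x Sx].
  by rewrite mem_cat => /orP[/gS // | /g'S/S'E[]].
have [a sxa] := sS _ Sx.
have Ia : I a by exists (x - a *: z); rewrite [a *: z + _]addrC subrK.
have [w [gw sw]] : exists w, in_span g w /\ in_span s (w - a *: z).
  by apply: gP; apply/ideal_genE; rewrite -lE.
have Sw : S w.
  elim: (g) (w) gS gw => [|y h IHh] v hS /=; first by move=> ->; apply: smod0.
  move=> [c hv]; rewrite -(subrK (c *: y) v); apply: smodD.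
    by apply: IHh => // u uh; apply: hS; rewrite inE uh orbT.
  by apply: smodZ; apply: hS; rewrite inE eqxx.
rewrite -(subrK w x) addrC; apply: span_cat => //; apply/g'P/S'E; split.
  exact: smodB.
rewrite -(subrKA (a *: z)); apply: spanD => //.
by rewrite -opprB -scaleN1r; apply: spanZ.
Qed.

Lemma fin_gen_inj U V (i : {linear U -> V}) :
  injective i -> fin_gen V -> fin_gen U.
Proof.
move=> i_inj /fin_genP[s sV].
have [|g [gS gP]] := @noetherian_span V (image_smod i) s; first by [].
have [h hE] : exists h, map i h = g.
  elim: g gS {gP} => [|y g IH] gS; first by exists [::].
  have [|h <-] := IH; first by move=> x xg; apply: gS; rewrite inE xg orbT.
  by have [|x <-] := gS y; [rewrite inE eqxx | exists (x :: h)].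
apply/fin_genP; exists h => x; apply: (span_map i_inj); rewrite hE.
by apply: gP; exists x.
Qed.

Lemma fin_gen_kernel U V (f : {linear U -> V}) : fin_gen U -> fin_gen (kernel f).
Proof. exact: fin_gen_inj (@kernel_incl_inj _ _ _ f). Qed.

End FinGen.

Section DualBasis.
Variable R : comNzRingType.
Implicit Types P Q : lmodType R.

Definition fg_proj P : Prop := fin_gen P /\ projective P.

Lemma free_fg_proj k : fg_proj 'rV[R]_k.
Proof. by split; [apply: free_fin_gen | apply: free_projective]. Qed.

(** Dual bases give explicit formulas for the dual and for the inverse of the
    evaluation map into the bidual. *)
Lemma dual_basisP P : fg_proj P <->
  exists k (e : 'I_k -> P) (phi : 'I_k -> dual P),
    forall x, x = \sum_i phi i x *: e i.
Proof.
split=> [[fgP projP] | [k [e [phi eP]]]].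
  have [k [f f_surj]] := fin_gen_cover fgP.
  have [s sE] := proj_lift_surj (idfun : {linear P -> P}) projP f_surj.
  have /choice[phi phiE] (i : 'I_k) : exists c : dual P, forall x, c x = s x 0 i.
    have [|c cE] := @linear_fun R P R^o (fun x => s x 0 i).
      by move=> a x y; rewrite linearP !mxE.
    by exists c.
  exists k, (fun i => f (delta_mx 0 i)), phi => x.
  rewrite -[LHS]sE {1}(row_sum_delta (s x)) linear_sum.
  by apply: eq_bigr => i _; rewrite linearZ phiE.
split; first by exists k, e => x; exists (fun i => phi i x).
move=> M N g f /choice[s gs].
have [|h hE] := @linear_fun R P M (fun x => \sum_i phi i x *: s (f (e i))).
  move=> a x y; rewrite scaler_sumr -big_split; apply: eq_bigr => i _ /=.
  by rewrite linearP scalerDl scalerA.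
exists h => x /=; rewrite hE linear_sum {2}(eP x) linear_sum.
by apply: eq_bigr => i _; rewrite !linearZ /= gs.
Qed.

Definition eval P (x : P) (phi : dual P) : R^o := phi x.

Fact eval_linear P (x : P) : linear (eval x).
Proof. by []. Qed.

HB.instance Definition _ P (x : P) :=
  GRing.isLinear.Build R (dual P) R^o _ (eval x) (eval_linear x).

Definition eval_map P (x : P) : dual (dual P) := (eval x : {linear _ -> _}).

Fact eval_map_linear P : linear (@eval_map P).
Proof. by move=> a x y; apply: hom_ext => phi /=; rewrite /eval linearP. Qed.

HB.instance Definition _ P :=
  GRing.isLinear.Build R P (dual (dual P)) _ (@eval_map P) (@eval_map_linear P).

Lemma dual_sumE P k (c : 'I_k -> dual P) x : (\sum_i c i) x = \sum_i c i x.
Proof. by elim/big_ind2: _ => // _ f _ g <- <-. Qed.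

Lemma dual_basis_dual P k (e : 'I_k -> P) (phi : 'I_k -> dual P) :
    (forall x, x = \sum_i phi i x *: e i) ->
  forall psi : dual P, psi = \sum_i psi (e i) *: phi i.
Proof.
move=> eP psi; apply: hom_ext => x; rewrite dual_sumE {1}(eP x) linear_sum.
by apply: eq_bigr => i _; rewrite linearZ; apply: mulrC.
Qed.

Lemma fg_proj_dual P : fg_proj P -> fg_proj (dual P).
Proof.
move=> /dual_basisP[k [e [phi eP]]]; apply/dual_basisP.
exists k, phi, (fun i => eval_map (e i)) => psi.
exact: dual_basis_dual.
Qed.

Lemma eval_map_inj P x : fg_proj P -> (forall phi : dual P, phi x = 0) -> x = 0.
Proof.
move=> /dual_basisP[k [e [phi eP]]] phix0; rewrite (eP x).
by rewrite big1 // => i _; rewrite phix0 scale0r.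
Qed.

Lemma eval_map_surj P : fg_proj P -> surjective (@eval_map P).
Proof.
move=> /dual_basisP[k [e [phi eP]]] xi.
exists (\sum_i xi (phi i) *: e i); apply: hom_ext => psi /=.
rewrite /eval linear_sum {2}(dual_basis_dual eP psi) linear_sum.
by apply: eq_bigr => i _; rewrite !linearZ; apply: mulrC.
Qed.

Lemma fg_proj_pair P Q : fg_proj P -> fg_proj Q -> fg_proj (P * Q)%type.
Proof.
move=> [fgP projP] [fgQ projQ]; split.
  have [k [f f_surj]] := fin_gen_cover fgP; have [l [g g_surj]] := fin_gen_cover fgQ.
  have [|h hE] := @linear_fun R 'rV[R]_(k + l) (P * Q)%type
      (fun x => (f (lsubmx x), g (rsubmx x))).
    by move=> a x y; rewrite !linearP.
  apply: (@fin_gen_surj _ _ _ h); last exact: free_fin_gen.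
  move=> [x y]; have [x' <-] := f_surj x; have [y' <-] := g_surj y.
  by exists (row_mx x' y'); rewrite hE row_mxKl row_mxKr.
move=> M N g f g_surj.
have [|fP fPE] := @linear_fun R P N (fun x => f (x, 0)).
  by move=> a x y; rewrite -linearP; congr (f (_, _)); rewrite /= scaler0 addr0.
have [|fQ fQE] := @linear_fun R Q N (fun y => f (0, y)).
  by move=> a x y; rewrite -linearP; congr (f (_, _)); rewrite /= scaler0 addr0.
have [hP hPE] := projP _ _ g fP g_surj; have [hQ hQE] := projQ _ _ g fQ g_surj.
have [|h hE] := @linear_fun R (P * Q)%type M (fun x => hP x.1 + hQ x.2).
  by move=> a x y; rewrite !linearP scalerDr addrACA.
exists h => [[x y]]; rewrite /= hE linearD [g (hP x)]hPE [g (hQ y)]hQE fPE fQE.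
by rewrite -linearD; congr (f (_, _)); rewrite /= ?addr0 ?add0r.
Qed.

End DualBasis.

(** * Vanishing of Ext *)

Section Ext.
Variable R : comNzRingType.
Implicit Types U V W M N T P Q K E Y Z : lmodType R.

(** Exactness of Hom(W, N) -> Hom(V, N) -> Hom(U, N) in the middle, in terms of
    plain linear maps. *)
Definition hom_exact U V W (d' : {linear U -> V}) (d : {linear V -> W}) N :=
  forall f : {linear V -> N}, (forall x, f (d' x) = 0) ->
  exists g : {linear W -> N}, forall x, g (d x) = f x.

Lemma exact_comp0 U V W (f : {linear U -> V}) (g : {linear V -> W}) x :
  exact_at f g -> g (f x) = 0.
Proof. by move=> fg; apply/fg; exists x. Qed.

Lemma hom_exactP U V W (d' : {linear U -> V}) (d : {linear V -> W}) N :
    exact_at d' d ->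
  exact_at (@hom_precomp R _ _ d N) (@hom_precomp R _ _ d' N) <->
  hom_exact d' d N.
Proof.
move=> ex; split=> [exN f fd'0 | exN f].
  have /exN[g gd] : hom_precomp d' (f : lin_hom V N) = 0.
    by apply: hom_ext => x; apply: fd'0.
  by exists g => x; rewrite -[RHS]/((f : lin_hom V N) x) -gd.
split=> [fd'0 | [g <-]]; last first.
  by apply: hom_ext => x /=; rewrite (exact_comp0 x ex) linear0.
have [x|g gd] := exN f; last by exists g; apply: hom_ext.
exact: (congr1 (fun h : lin_hom U N => h x) fd'0).
Qed.

(** If the identity of T factors through T' up to a map through a projective,
    then a resolution of T is, up to homotopy, a retract of a resolution of T'
    in positive degrees. *)
Lemma stable_retract_lift T T' Q (P : proj_resolution T)
    (P' : proj_resolution T') (a : {linear T -> T'}) (b : {linear T' -> T})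
    (u : {linear T -> Q}) (v : {linear Q -> T}) :
    projective Q -> (forall x, x = b (a x) + v (u x)) ->
  forall j, exists
    (a0 : {linear res_obj P j -> res_obj P' j})
    (a1 : {linear res_obj P j.+1 -> res_obj P' j.+1})
    (b0 : {linear res_obj P' j -> res_obj P j})
    (b1 : {linear res_obj P' j.+1 -> res_obj P j.+1})
    (s0 : {linear res_obj P j -> res_obj P j.+1})
    (s1 : {linear res_obj P j.+1 -> res_obj P j.+2}),
    [/\ forall x, res_diff P' j (a1 x) = a0 (res_diff P j x),
        forall x, res_diff P j (b1 x) = b0 (res_diff P' j x)
      & forall x, x = b1 (a1 x) + res_diff P j.+1 (s1 x) +
                      s0 (res_diff P j x)].
Proof.
move=> projQ retr; elim=> [|j [a0 [a1 [b0 [b1 [s0 [s1 [aE bE sE]]]]]]]]; last first.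
  have [|a2 a2E] := proj_lift (f := a1 \o res_diff P j.+1 : {linear _ -> _})
      (@res_proj _ _ P j.+2) (@res_exact _ _ P' j).
    by move=> x /=; rewrite aE (exact_comp0 x (@res_exact _ _ P j)) linear0.
  have [|b2 b2E] := proj_lift (f := b1 \o res_diff P' j.+1 : {linear _ -> _})
      (@res_proj _ _ P' j.+2) (@res_exact _ _ P j).
    by move=> x /=; rewrite bE (exact_comp0 x (@res_exact _ _ P' j)) linear0.
  have [|s2 s2E] := proj_lift
      (f := (idfun \- (b2 \o a2)) \- (s1 \o res_diff P j.+1) : {linear _ -> _})
      (@res_proj _ _ P j.+2) (@res_exact _ _ P j.+1).
    move=> x /=; rewrite !linearB b2E /= a2E /=.
    rewrite {1}(sE (res_diff P j.+1 x)) (exact_comp0 x (@res_exact _ _ P j)).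
    by rewrite linear0 addr0 -addrA -opprD subrr.
  exists a1, a2, b1, b2, s1, s2; split=> // x.
  by rewrite s2E /= -addrA subrK addrC subrK.
have [a0 a0E] := proj_lift_surj (a \o res_aug P : {linear _ -> _})
    (@res_proj _ _ P 0) (res_surj P').
have [b0 b0E] := proj_lift_surj (b \o res_aug P' : {linear _ -> _})
    (@res_proj _ _ P' 0) (res_surj P).
have [v0 v0E] := proj_lift_surj v projQ (res_surj P).
have [|s0 s0E] := proj_lift
    (f := (idfun \- (b0 \o a0)) \- (v0 \o u \o res_aug P) : {linear _ -> _})
    (@res_proj _ _ P 0) (@res_exact0 _ _ P).
  move=> x /=; rewrite !linearB b0E /= a0E /= v0E {1}(retr (res_aug P x)).
  by rewrite -addrA -opprD subrr.
have [|a1 a1E] := proj_lift (f := a0 \o res_diff P 0 : {linear _ -> _})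
    (@res_proj _ _ P 1) (@res_exact0 _ _ P').
  by move=> x /=; rewrite a0E /= (exact_comp0 x (@res_exact0 _ _ P)) linear0.
have [|b1 b1E] := proj_lift (f := b0 \o res_diff P' 0 : {linear _ -> _})
    (@res_proj _ _ P' 1) (@res_exact0 _ _ P).
  by move=> x /=; rewrite b0E /= (exact_comp0 x (@res_exact0 _ _ P')) linear0.
have [|s1 s1E] := proj_lift
    (f := (idfun \- (b1 \o a1)) \- (s0 \o res_diff P 0) : {linear _ -> _})
    (@res_proj _ _ P 1) (@res_exact _ _ P 0).
  move=> x /=; rewrite !linearB b1E /= a1E /= s0E /=.
  by rewrite (exact_comp0 x (@res_exact0 _ _ P)) !linear0 addr0 subrr.
exists a0, a1, b0, b1, s0, s1; split=> // x.
by rewrite s1E /= -addrA subrK addrC subrK.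
Qed.

(** A cocycle f on a resolution of T goes to a cocycle f b on the resolution of
    T', which is a coboundary; the homotopy carries this back to f. *)
Lemma Ext_stable_retract T T' Q (P : proj_resolution T)
    (a : {linear T -> T'}) (b : {linear T' -> T})
    (u : {linear T -> Q}) (v : {linear Q -> T}) i N :
    projective Q -> (forall x, x = b (a x) + v (u x)) ->
  Ext_eq0 i.+1 T' N -> hom_exact (res_diff P i.+1) (res_diff P i) N.
Proof.
move=> projQ retr [P' /(hom_exactP _ (@res_exact _ _ P' i)) exP'] f fd0.
have [a0 [a1 [b0 [b1 [s0 [s1 [aE bE sE]]]]]]] :=
  stable_retract_lift P P' projQ retr i.
have [|h hE] := exP' (f \o b1 : {linear _ -> _}).
  move=> x /=; have /(@res_exact _ _ P i)[y <-] :
      res_diff P i (b1 (res_diff P' i.+1 x)) = 0.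
    by rewrite bE (exact_comp0 x (@res_exact _ _ P' i)) linear0.
  exact: fd0.
exists ((h \o a0) \+ (f \o s0) : {linear _ -> _}) => x /=.
by rewrite -aE hE /= [in RHS](sE x) !linearD fd0 addr0.
Qed.

(** Any module is a stable retract of itself, so the choice of the resolution
    does not matter. *)
Lemma Ext_eq0P M (P : proj_resolution M) i N :
  Ext_eq0 i.+1 M N <-> hom_exact (res_diff P i.+1) (res_diff P i) N.
Proof.
split=> [|exP]; last by exists P; apply/hom_exactP => //; apply: res_exact.
apply: (@Ext_stable_retract M M 'rV[R]_0 P idfun idfun \0 \0) => [|x /=].
  exact: free_projective.
by rewrite addr0.
Qed.

(** The exact sequence Ext^i(M, N) -> Ext^i(M, N'') -> Ext^(i+1)(M, N'): a
    cocycle with values in N'' lifts to N, and its defect is a cocycle with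
    values in N'. *)
Lemma Ext_long_exact M N' N N'' (f : {linear N' -> N}) (g : {linear N -> N''}) i :
    short_exact f g -> Ext_eq0 i.+1 M N -> Ext_eq0 i.+2 M N' ->
  Ext_eq0 i.+1 M N''.
Proof.
move=> [f_inj fg g_surj] [P exN].
move/(hom_exactP _ (@res_exact _ _ P i)): exN => exN /(Ext_eq0P P) exN'.
apply/(Ext_eq0P P) => c cd0.
have [h hE] := proj_lift_surj c (@res_proj _ _ P i.+1) g_surj.
have [x|e eE] := factor_inj (f := h \o res_diff P i.+1 : {linear _ -> _}) f_inj.
  by apply/fg; rewrite /= hE cd0.
have [x|k kE] := exN' e.
  by apply: f_inj; rewrite eE /= (exact_comp0 x (@res_exact _ _ P i.+1)) !linear0.
have [x|l lE] := exN (h \- (f \o k) : {linear _ -> _}).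
  by rewrite /= kE eE subrr.
exists (g \o l : {linear _ -> _}) => x /=.
by rewrite lE /= linearB hE (exact_comp0 (k x) fg) subr0.
Qed.

(** The splicing of 0 -> K -> P -> M -> 0 with a resolution of K. *)
Section Splice.
Variables (K P M : lmodType R) (i : {linear K -> P}) (p : {linear P -> M}).
Hypotheses (projP : projective P) (exKPM : short_exact i p).
Variable Q : proj_resolution K.

Definition splice_obj j : lmodType R := if j is j'.+1 then res_obj Q j' else P.

Definition splice_diff j : {linear splice_obj j.+1 -> splice_obj j} :=
  match j return {linear splice_obj j.+1 -> splice_obj j} with
  | 0 => (i \o res_aug Q : {linear _ -> _})
  | j'.+1 => res_diff Q j'
  end.

Fact splice_proj j : projective (splice_obj j).
Proof. by case: j => [|j] //; apply: res_proj. Qed.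

Fact splice_exact j : exact_at (splice_diff j.+1) (splice_diff j).
Proof.
case: j => [|j] /=; last exact: res_exact.
have [i_inj _ _] := exKPM; move=> x; rewrite -(@res_exact0 _ _ Q x) /=.
split=> [ix0|->]; last exact: linear0.
by apply: i_inj; rewrite ix0 linear0.
Qed.

Fact splice_exact0 : exact_at (splice_diff 0) p.
Proof.
have [_ ip _] := exKPM; move=> x; rewrite (ip x).
split=> [[y <-]|[y <-]]; last by exists (res_aug Q y).
by have [z <-] := res_surj Q y; exists z.
Qed.

Definition splice : proj_resolution M :=
  @ProjResolution R M splice_obj splice_diff p splice_proj splice_exact
    splice_exact0 (let: And3 _ _ p_surj := exKPM in p_surj).

End Splice.

Definition resolvable M := inhabited (proj_resolution M).

(** Dimension shifting: on a spliced resolution the two conditions are literally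
    the same. *)
Lemma Ext_shift K P M (i : {linear K -> P}) (p : {linear P -> M}) j N :
    resolvable K -> projective P -> short_exact i p ->
  Ext_eq0 j.+2 M N <-> Ext_eq0 j.+1 K N.
Proof.
move=> [Q] projP ex; rewrite (Ext_eq0P (splice projP ex Q)).
by rewrite (Ext_eq0P Q).
Qed.

Lemma Ext1_of_extension K P M (i : {linear K -> P}) (p : {linear P -> M}) N :
    resolvable K -> projective P -> short_exact i p ->
    (forall h : {linear K -> N},
       exists k : {linear P -> N}, forall x, k (i x) = h x) ->
  Ext_eq0 1 M N.
Proof.
move=> [Q] projP ex extN; apply/(Ext_eq0P (splice projP ex Q)) => /= f fd0.
have [y|h hE] := factor_surj (f := f) (res_surj Q).
  by move=> /(@res_exact0 _ _ Q)[x <-]; apply: fd0.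
by have [k kE] := extN h; exists k => x; rewrite /= kE hE.
Qed.

(** The exact sequence Hom(Y, N) -> Hom(E, N) -> Ext^1(Z, N). *)
Lemma extension_of_Ext1 E Y Z (f : {linear E -> Y}) (g : {linear Y -> Z}) N
    (h : {linear E -> N}) :
    short_exact f g -> Ext_eq0 1 Z N ->
  exists k : {linear Y -> N}, forall x, k (f x) = h x.
Proof.
move=> [f_inj fg g_surj] [P exN].
move/(hom_exactP _ (@res_exact _ _ P 0)): exN => exN.
have [l lE] := proj_lift_surj (res_aug P) (@res_proj _ _ P 0) g_surj.
have [x|e eE] := factor_inj (f := l \o res_diff P 0 : {linear _ -> _}) f_inj.
  by apply/fg; rewrite /= lE (exact_comp0 x (@res_exact0 _ _ P)).
have [x|w wE] := exN (h \o e : {linear _ -> _}).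
  rewrite /=; have -> : e (res_diff P 1 x) = 0; last exact: linear0.
  by apply: f_inj; rewrite eE /= (exact_comp0 x (@res_exact _ _ P 0)) !linear0.
(* Y is the pushout of E and P_0 along P_1. *)
have [|q qE] := @linear_fun R (res_obj P 0 * E)%type Y (fun z => l z.1 + f z.2).
  by move=> a x y; rewrite !linearP scalerDr addrACA.
have [|c cE] := @linear_fun R (res_obj P 0 * E)%type N (fun z => w z.1 + h z.2).
  by move=> a x y; rewrite !linearP scalerDr addrACA.
have q_surj : surjective q.
  move=> y; have [x xE] := res_surj P (g y).
  have /fg[z zE] : g (y - l x) = 0 by rewrite linearB lE xE subrr.
  by exists (x, z); rewrite qE /= zE addrC subrK.
have [[x z]|k kE] := factor_surj (f := c) q_surj.
  rewrite qE cE /= => q0.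
  have /(@res_exact0 _ _ P)[t tE] : res_aug P x = 0.
    by have := congr1 g q0; rewrite linearD (exact_comp0 z fg) addr0 lE linear0.
  have zE : z = - e t.
    apply: f_inj; apply/eqP; rewrite linearN eE /= tE -addr_eq0 addrC.
    exact/eqP.
  by rewrite zE -tE wE /= linearN subrr.
exists k => x; have /= := kE (0, x).
by rewrite qE cE /= !linear0 !add0r.
Qed.

End Ext.

Section Resolutions.
Variable R : comNzRingType.
Hypothesis R_noetherian : noetherian R.
Implicit Types M K P : lmodType R.

(** A free cover is chosen for every module at once, with junk where there is
    none, so that syzygies can be iterated as a function on modules. *)
Definition cover_of M :
  {k : nat & {p : {linear 'rV[R]_k -> M} | fin_gen M -> surjective p}}.
Proof.
case: (pselect (fin_gen M)) => [fgM | nfgM]; last first.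
  by exists 0%N, (\0 : {linear _ -> _}).
have /cid[k /cid[p p_surj]] := fin_gen_cover fgM.
by exists k, p.
Qed.

Definition cover_rank M : nat := projT1 (cover_of M).
Definition free_cover M : {linear 'rV[R]_(cover_rank M) -> M} :=
  sval (projT2 (cover_of M)).

Lemma cover_surj M : fin_gen M -> surjective (free_cover M).
Proof. exact: (svalP (projT2 (cover_of M))). Qed.

Definition free_syzygy j M : lmodType R :=
  iter j (fun K => kernel (free_cover K) : lmodType R) M.

Lemma fin_gen_free_syzygy j M : fin_gen M -> fin_gen (free_syzygy j M).
Proof.
move=> fgM; elim: j => [|j IH] //=.
exact: fin_gen_kernel (free_fin_gen _ _).
Qed.

Definition free_res_diff M j :
    {linear 'rV[R]_(cover_rank (free_syzygy j.+1 M)) ->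
            'rV[R]_(cover_rank (free_syzygy j M))} :=
  kernel_incl (free_cover (free_syzygy j M)) \o free_cover (free_syzygy j.+1 M).

Lemma free_res_exact0 M j : fin_gen M ->
  exact_at (free_res_diff M j) (free_cover (free_syzygy j M)).
Proof.
move=> fgM x; split=> [|[y <-]]; last exact: kernel_inclK.
move=> /kernel_lift[y <-].
by have [z <-] := cover_surj (@fin_gen_free_syzygy j.+1 M fgM) y; exists z.
Qed.

Lemma free_res_exact M j : fin_gen M ->
  exact_at (free_res_diff M j.+1) (free_res_diff M j).
Proof.
move=> fgM x; rewrite -(@free_res_exact0 M j.+1 fgM x).
rewrite -[free_res_diff M j x]/(kernel_incl _ (free_cover (free_syzygy j.+1 M) x)).
split=> [ix0|->]; last exact: linear0.
by apply: kernel_incl_inj; rewrite ix0 linear0.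
Qed.

Definition free_resolution M (fgM : fin_gen M) : proj_resolution M :=
  @ProjResolution R M (fun j => 'rV[R]_(cover_rank (free_syzygy j M)))
    (free_res_diff M) (free_cover M) (fun j => @free_projective R _)
    (fun j => @free_res_exact M j fgM) (@free_res_exact0 M 0 fgM) (cover_surj fgM).

Lemma resolvable_fg M : fin_gen M -> resolvable M.
Proof. by move=> fgM; split; apply: free_resolution. Qed.

Lemma Ext_projective P i N : fg_proj P -> Ext_eq0 i.+1 P N.
Proof.
have ex (Q : lmodType R) :
    short_exact (\0 : {linear 'rV[R]_0 -> Q}) (idfun : {linear Q -> Q}).
  split; [by move=> x y _; apply/rowP; case | | by move=> x; exists x].
  by move=> x /=; split=> [->|[_ <-] //]; exists 0.
have res0 : resolvable 'rV[R]_0 by apply/resolvable_fg/free_fin_gen.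
elim: i P => [|i IH] P [fgP projP]; last first.
  by apply/(Ext_shift _ _ res0 projP (ex P))/IH; apply: free_fg_proj.
apply: (Ext1_of_extension res0 projP (ex P)) => h.
exists (\0 : {linear _ -> _}) => x /=.
by rewrite (_ : x = 0) ?linear0 //; apply/rowP; case.
Qed.

End Resolutions.

(** * Transposes *)

Section Transposes.
Variable R : comNzRingType.
Implicit Types M T P Q : lmodType R.

Local Notation dmap d := (@hom_precomp R _ _ d R^o).

Lemma hom_app (U V : lmodType R) (f g : lin_hom U V) x : f = g -> f x = g x.
Proof. by move=> ->. Qed.

(** Comparing two presentations of M and dualizing, the part of the homotopy
    in degree 1 that is killed by d becomes a map on T through the projective
    module dual P1. *)
Lemma Ext_transpose M T T' i N :
    resolvable T -> is_transpose M T -> is_transpose M T' ->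
  Ext_eq0 i.+1 T' N -> Ext_eq0 i.+1 T N.
Proof.
move=> [res] [P1 [P0 [d [p [q [fgP1 [_ projP0] [dp p_surj] dq q_surj]]]]]].
move=> [P1' [P0' [d' [p' [q' [fgP1' [_ projP0'] [dp' p_surj'] dq' q_surj']]]]]].
have projP1 := fgP1.2; have projP1' := fgP1'.2.
have [a0 a0E] := proj_lift_surj p projP0 p_surj'.
have [b0 b0E] := proj_lift_surj p' projP0' p_surj.
have [x|a1 a1E] := proj_lift (f := a0 \o d : {linear _ -> _}) projP1 dp'.
  by rewrite /= a0E (exact_comp0 x dp).
have [x|b1 b1E] := proj_lift (f := b0 \o d' : {linear _ -> _}) projP1' dp.
  by rewrite /= b0E (exact_comp0 x dp').
have [x|s sE] := proj_lift (f := idfun \- (b0 \o a0) : {linear _ -> _}) projP0 dp.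
  by rewrite /= linearB b0E a0E subrr.
pose e : {linear P1 -> P1} := idfun \- (b1 \o a1) \- (s \o d) : {linear _ -> _}.
have de x : d (e x) = 0.
  by rewrite /= !linearB b1E /= a1E /= sE /= subrr.
have [psi|alpha alphaE] :=
    factor_surj (f := q \o dmap a1 : {linear _ -> _}) q_surj'.
  move=> /dq'[phi <-] /=; apply/dq; exists (dmap a0 phi).
  by apply: hom_ext => x /=; rewrite a1E.
have [psi|beta betaE] :=
    factor_surj (f := q' \o dmap b1 : {linear _ -> _}) q_surj.
  move=> /dq[phi <-] /=; apply/dq'; exists (dmap b0 phi).
  by apply: hom_ext => x /=; rewrite b1E.
have [psi|eps epsE] := factor_surj (f := dmap e : {linear _ -> _}) q_surj.
  by move=> /dq[phi <-]; apply: hom_ext => x /=; rewrite de linear0.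
move=> ExtT'; apply/(Ext_eq0P res).
apply: (Ext_stable_retract (T' := T') (a := beta) (b := alpha) (u := eps)
          (v := q) _ _ ExtT').
  exact: (fg_proj_dual fgP1).2.
move=> t; have [psi <-] := q_surj t.
rewrite betaE /= alphaE epsE /= -linearD.
apply/eqP; rewrite -subr_eq0 -linearB; apply/eqP/dq; exists (dmap s psi).
apply: hom_ext => x /=; rewrite !linearB /=.
by rewrite [psi (b1 _) + _]addrC [X in _ - X]addrAC subrK subKr.
Qed.

(** Dualizing the presentation twice gives it back, since finitely generated
    projectives are reflexive. *)
Lemma transpose_sym M T : is_transpose M T -> is_transpose T M.
Proof.
move=> [P1 [P0 [d [p [q [fgP1 fgP0 [dp p_surj] dq q_surj]]]]]].
have [x|r rE] := factor_surj (f := p) (eval_map_surj fgP0).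
  move=> ev0; suff -> : x = 0 by exact: linear0.
  by apply: (eval_map_inj fgP0) => phi; rewrite -[LHS]/(eval_map x phi) ev0.
exists (dual P0), (dual P1), (dmap d), q, r; split=> //.
- exact: fg_proj_dual.
- exact: fg_proj_dual.
- move=> xi; have [x <-] := eval_map_surj fgP0 xi; rewrite rE; split.
    by move=> /dp[y <-]; exists (eval_map y); apply: hom_ext.
  move=> [zeta]; have [y <-] := eval_map_surj fgP1 zeta => e.
  transitivity (r (eval_map x)); first exact/esym/rE.
  rewrite -e; transitivity (r (eval_map (d y))).
    by congr (r _); apply: hom_ext.
  by rewrite rE (exact_comp0 y dp).
- by move=> z; have [x <-] := p_surj z; exists (eval_map x); apply: rE.
Qed.

Lemma fin_gen_transpose M T : is_transpose M T -> fin_gen T.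
Proof.
move=> [P1 [P0 [d [p [q [fgP1 _ _ _ q_surj]]]]]].
exact: fin_gen_surj q_surj (fg_proj_dual fgP1).1.
Qed.

Section Cosyzygy.
Variables (F2 F1 F0 : lmodType R).
Variables (d1 : {linear F2 -> F1}) (d0 : {linear F1 -> F0}).
Hypotheses (fgF2 : fg_proj F2) (fgF1 : fg_proj F1) (fgF0 : fg_proj F0).
Hypothesis exd : exact_at d1 d0.
Variables (C0 : lmodType R) (q0 : {linear dual F1 -> C0}).
Hypotheses (exq0 : exact_at (dmap d0) q0) (q0_surj : surjective q0).

(** Functionals on the transpose are elements of F1 killed by d0, hence of the
    image of F2. *)
Lemma transpose_functional (h : {linear C0 -> R^o}) :
  exists y : F2, forall psi : dual F1, h (q0 psi) = psi (d1 y).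
Proof.
have [x xE] := eval_map_surj fgF1 (h \o q0 : {linear _ -> _}).
have /exd[y yE] : d0 x = 0.
  apply: (eval_map_inj fgF0) => phi.
  rewrite -[LHS]/(eval_map x (dmap d0 phi)) xE /=.
  by rewrite (exact_comp0 phi exq0) linear0.
exists y => psi; rewrite yE.
exact: esym (hom_app psi xE).
Qed.

Variables (C1 : lmodType R) (q1 : {linear dual F2 -> C1}).
Hypotheses (exq1 : exact_at (dmap d1) q1) (q1_surj : surjective q1).
Hypothesis exR : hom_exact d1 d0 R^o.

(** Exactness of the dual sequence at F1 makes the transpose a submodule of
    dual F2; a functional on it is evaluation at a point of F1 that comes from
    F2, and evaluation at a preimage extends it. *)
Lemma transpose_cosyzygy : exists iota : {linear C0 -> dual F2},
  short_exact iota q1 /\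
  forall h : {linear C0 -> R^o}, exists k : {linear dual F2 -> R^o},
    forall x, k (iota x) = h x.
Proof.
have ker0 psi : q0 psi = 0 <-> dmap d1 psi = 0.
  by rewrite (exq0 psi) -((hom_exactP _ exd).2 exR psi).
have [psi|iota iotaE] := factor_surj (f := dmap d1 : {linear _ -> _}) q0_surj.
  by move=> /ker0.
exists iota; split=> [|h].
  split=> // [c c' | psi].
    have [psi <-] := q0_surj c; have [psi' <-] := q0_surj c'.
    rewrite !iotaE => e; apply/eqP; rewrite -subr_eq0 -linearB; apply/eqP/ker0.
    by rewrite linearB e subrr.
  rewrite (exq1 psi); split=> [[phi <-]|[c <-]].
    by exists (q0 phi); rewrite iotaE.
  by have [phi <-] := q0_surj c; exists phi; rewrite iotaE.
have [y yE] := transpose_functional h.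
exists (eval_map y) => c; have [psi <-] := q0_surj c.
by rewrite iotaE yE.
Qed.

Hypothesis C0_resolvable : resolvable C0.

Lemma Ext1_cosyzygy : Ext_eq0 1 C1 R^o.
Proof.
have [iota [ex extR]] := transpose_cosyzygy.
exact: (Ext1_of_extension C0_resolvable (fg_proj_dual fgF2).2 ex extR).
Qed.

Lemma Ext_cosyzygy i N : Ext_eq0 i.+2 C1 N <-> Ext_eq0 i.+1 C0 N.
Proof.
have [iota [ex _]] := transpose_cosyzygy.
exact: (Ext_shift _ _ C0_resolvable (fg_proj_dual fgF2).2 ex).
Qed.

End Cosyzygy.

(** * Torsionfreeness and total reflexivity *)

Definition Ext_vanish (n : int) T : Prop :=
  forall i : nat, (1 <= i)%N -> i%:Z <= n -> Ext_eq0 i T R^o.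

Hypothesis R_noetherian : noetherian R.

Lemma TF_transpose n M T : TF n M -> is_transpose M T -> Ext_vanish n T.
Proof.
move=> [_ [T' MT' ExtT']] MT [|i] // i1 ilen.
have resT := resolvable_fg R_noetherian (fin_gen_transpose MT).
exact: Ext_transpose resT MT MT' (ExtT' _ i1 ilen).
Qed.

Lemma free_res_fg_proj M (fgM : fin_gen M) j :
  fg_proj (res_obj (free_resolution R_noetherian fgM) j).
Proof. exact: free_fg_proj. Qed.

Lemma free_res_transpose M (fgM : fin_gen M) :
  let G := free_resolution R_noetherian fgM in
  is_transpose M (quot (image_smod (dmap (res_diff G 0)))).
Proof.
move=> G; exists (res_obj G 1), (res_obj G 0), (res_diff G 0), (res_aug G).
exists (quot_proj _); split.
- exact: free_fg_proj.
- exact: free_fg_proj.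
- by split; [apply: res_exact0 | apply: res_surj].
- exact: coker_exact.
- exact: quot_proj_surj.
Qed.

Lemma cover_short_exact M : fin_gen M ->
  short_exact (kernel_incl (free_cover M)) (free_cover M).
Proof.
move=> fgM; split; [exact: kernel_incl_inj | exact: kernel_exact |].
exact: cover_surj.
Qed.

Lemma fin_gen_syzygy M : fin_gen (kernel (free_cover M)).
Proof. exact: fin_gen_kernel (free_fin_gen _ _). Qed.

Lemma Ext_syzygy M i N :
  fin_gen M -> Ext_eq0 i.+2 M N <-> Ext_eq0 i.+1 (kernel (free_cover M)) N.
Proof.
move=> fgM; have resK := resolvable_fg R_noetherian (fin_gen_syzygy M).
exact: (Ext_shift _ _ resK (@free_projective R _) (cover_short_exact fgM)).
Qed.

(** The dual of a resolution of T being exact in positive degrees, it is a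
    coresolution of the transpose of T by projectives; as the dual of this
    coresolution is exact again, its j-th cosyzygy has no Ext into R in degrees
    1 to j. *)
Lemma cosyzygy_sequence T (fgT : fin_gen T) :
    let F := free_resolution R_noetherian fgT in
    let C j : lmodType R := quot (image_smod (dmap (res_diff F j))) in
    (forall i, Ext_eq0 i.+1 T R^o) ->
  [/\ forall j, fin_gen (C j),
      forall j i, (i < j)%N -> Ext_eq0 i.+1 (C j) R^o
    & forall j i, Ext_eq0 (i + j).+1 (C j) R^o <-> Ext_eq0 i.+1 (C 0) R^o].
Proof.
move=> F C ExtT.
have fgC j : fin_gen (C j).
  apply: (fin_gen_surj (@quot_proj_surj _ _ _)).
  exact: (fg_proj_dual (free_res_fg_proj fgT j.+1)).1.
have resC j := resolvable_fg R_noetherian (fgC j).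
have exF j : hom_exact (res_diff F j.+1) (res_diff F j) R^o by apply/Ext_eq0P.
have fgF j : fg_proj (res_obj F j) by exact: free_res_fg_proj.
have ExtC1 j : Ext_eq0 1 (C j.+1) R^o.
  exact: (Ext1_cosyzygy (fgF _) (fgF _) (fgF _) (@res_exact _ _ F j)
    (coker_exact _) (@quot_proj_surj _ _ _) (coker_exact _)
    (@quot_proj_surj _ _ _) (exF j) (resC j)).
have ExtC j i : Ext_eq0 i.+2 (C j.+1) R^o <-> Ext_eq0 i.+1 (C j) R^o.
  exact: (Ext_cosyzygy (fgF _) (fgF _) (fgF _) (@res_exact _ _ F j)
    (coker_exact _) (@quot_proj_surj _ _ _) (coker_exact _)
    (@quot_proj_surj _ _ _) (exF j) (resC j)).
split=> // [|j i].
  elim=> [|j IH] [|i] // ij; apply/ExtC; exact: IH.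
by elim: j => [|j IH]; rewrite ?addn0 // addnS ExtC.
Qed.

(** Every T is a transpose, so the assumption adds one more vanishing Ext to the
    first n; the syzygy of T then satisfies the same hypothesis, and one moves
    up degree by degree. *)
Lemma Ext_vanish_stable (n : nat) : (0 < n)%N ->
    (forall M, TF n%:Z M -> TF (n.+1%:Z) M) ->
  forall T, fin_gen T -> Ext_vanish n%:Z T -> forall i, Ext_eq0 i.+1 T R^o.
Proof.
move=> n_gt0 stab.
have next T : fin_gen T -> Ext_vanish n T -> Ext_eq0 n.+1 T R^o.
  move=> fgT ExtT; have TM := free_res_transpose fgT.
  have MT := transpose_sym TM.
  apply: (TF_transpose (stab _ _) MT) => //.
  by split; [exact: fin_gen_transpose TM | exists T].
have above i T : fin_gen T -> Ext_vanish n T -> Ext_eq0 (n + i) T R^o.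
  elim: i T => [|i IH] T fgT ExtT; first by rewrite addn0; apply: ExtT.
  rewrite addnS -(prednK n_gt0) addSn; apply/(Ext_syzygy _ _ fgT).
  rewrite -addSn prednK //; apply: IH; first exact: fin_gen_syzygy.
  move=> [|j] // _; rewrite lez_nat => jn; apply/(Ext_syzygy _ _ fgT).
  move: jn; rewrite leq_eqVlt => /orP[/eqP-> | jn]; first exact: next.
  by apply: ExtT; rewrite // lez_nat.
move=> T fgT ExtT i; case: (leqP i.+1 n) => [lein | /ltnW ltni].
  by apply: ExtT; rewrite // lez_nat.
by rewrite -(subnKC ltni); apply: above.
Qed.

(** M is an n-th syzygy of the n-th cosyzygy C n, to which [Ext_vanish_stable]
    applies. *)
Lemma TF_stable_totally_reflexive (n : nat) : (0 < n)%N ->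
    (forall M, TF n%:Z M -> TF (n.+1%:Z) M) ->
  forall M, TF n%:Z M -> totally_reflexive M.
Proof.
move=> n_gt0 /(Ext_vanish_stable n_gt0) stab M [fgM [T MT ExtT]].
have fgT := fin_gen_transpose MT.
have ExtT' := stab T fgT ExtT.
split=> //; last by exists T => // -[|i].
have [fgC ExtC shiftC] := cosyzygy_sequence fgT ExtT'.
move=> [|i] // _.
apply: (@Ext_transpose T) (transpose_sym MT) (free_res_transpose fgT) _.
  exact: resolvable_fg.
apply/(shiftC n i)/stab => // -[|j] // _.
by rewrite lez_nat => jn; apply: ExtC.
Qed.

End Transposes.

(** * Zero divisors in noetherian local rings *)

Section NoetherianRing.
Variable R : comNzRingType.
Implicit Types (I J K : set R) (s : seq R).

Lemma ideal_ideal_gen s : ideal (ideal_gen s).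
Proof.
split=> [|a b|r a].
- exists (fun=> 0); rewrite big1 // => i _; exact: mul0r.
- move=> [c ->] [d ->]; exists (fun i => c i + d i).
  by rewrite -big_split; apply: eq_bigr => i _; rewrite mulrDl.
- move=> [c ->]; exists (fun i => r * c i).
  by rewrite mulr_sumr; apply: eq_bigr => i _; rewrite mulrA.
Qed.

Lemma idealB I a b : ideal I -> I a -> I b -> I (a - b).
Proof.
by move=> [_ ID IM] Ia Ib; apply: ID => //; rewrite -mulN1r; apply: IM.
Qed.

Lemma ideal_gen_sub I s : ideal I -> (forall b, b \in s -> I b) ->
  (ideal_gen s `<=` I)%classic.
Proof.
move=> [I0 ID IM] sI _ [c ->]; elim/big_ind: _ => // i _.
by apply/IM/sI/mem_nth.
Qed.

Lemma ideal_gen_rcons s y x :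
  ideal_gen (rcons s y) x <-> exists a, ideal_gen s (x - a * y).
Proof.
split=> [[c ->]|[a [c cE]]].
  exists (c (size s)), c; rewrite size_rcons big_ord_recr /=.
  rewrite nth_rcons ltnn eqxx addrK; apply: eq_bigr => i _.
  by rewrite nth_rcons ltn_ord.
exists (fun i => if (i < size s)%N then c i else a).
rewrite size_rcons big_ord_recr /= ltnn nth_rcons ltnn eqxx.
rewrite -[LHS](subrK (a * y)) cE; congr (_ + _); apply: eq_bigr => i _.
by rewrite nth_rcons ltn_ord.
Qed.

Hypothesis R_noetherian : noetherian R.

(** Otherwise dependent choice gives a strictly increasing chain, and the
    generators of its union all lie in one member. *)
Lemma ideal_maximal (F : set R -> Prop) I0 :
    (forall I, F I -> ideal I) -> F I0 ->
  exists J, [/\ F J, (I0 `<=` J)%classic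
              & forall K, F K -> (J `<=` K)%classic -> K = J].
Proof.
move=> Fideal FI0; apply: contrapT => nomax.
pose T := {J | F J /\ (I0 `<=` J)%classic}.
have /choice[g gP] (J : T) :
    exists K : T, (sval J `<=` sval K)%classic /\ ~ (sval K `<=` sval J)%classic.
  case: J => J [FJ I0J]; apply: contrapT => noK; apply: nomax.
  exists J; split=> // K FK JK; apply/seteqP; split=> //.
  apply: contrapT => nKJ; apply: noK.
  by exists (exist _ K (conj FK (subset_trans I0J JK))).
pose I n := sval (iter n g (exist _ I0 (conj FI0 (@subset_refl _ I0)) : T)).
have Imono n k : (n <= k)%N -> (I n `<=` I k)%classic.
  move=> /subnK <-; elim: (k - n)%N => [|j IH] //.
  by apply: subset_trans IH _; apply: (gP _).1.
have idI n : ideal (I n).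
  by apply: Fideal; rewrite /I; case: (iter _ _ _) => J [].
have idU : ideal [set a | exists n, I n a]%classic.
  split=> [|a b [n Ia] [k Ib]|r a [n Ia]].
  - by exists 0%N; case: (idI 0%N).
  - exists (maxn n k); have [_ ID _] := idI (maxn n k).
    apply: ID; [apply: Imono Ia | apply: Imono Ib]; rewrite leq_max leqnn //.
    by rewrite orbT.
  - by exists n; have [_ _ IM] := idI n; apply: IM.
have [s UE] := R_noetherian idU.
have [n sn] : exists n, forall b, b \in s -> I n b.
  have: forall b, b \in s -> exists n, I n b.
    by move=> b /mem_ideal_gen; rewrite -UE.
  elim: (s) => [|c s' IH] Us; first by exists 0%N.
  have [|n nP] := IH; first by move=> b bs; apply: Us; rewrite inE bs orbT.
  have [|k Ic] := Us c; first by rewrite inE eqxx.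
  exists (maxn n k) => b; rewrite inE => /orP[/eqP-> | /nP].
    by apply: Imono Ic; rewrite leq_max leqnn orbT.
  by apply: Imono; rewrite leq_max leqnn.
apply: ((gP (iter n g _)).2) => a Ia.
by apply: (ideal_gen_sub (idI n) sn); rewrite -UE; exists n.+1.
Qed.

Definition prime_ideal I :=
  [/\ ideal I, ~ I 1 & forall a b, I (a * b) -> I a \/ I b].

(** Multiply one element of each A l outside P. *)
Lemma prime_not_sub_inter (A : R -> set R) P (L : seq R) :
    prime_ideal P -> (forall l, l \in L -> ideal (A l)) ->
    (forall l, l \in L -> ~ (A l `<=` P)%classic) ->
  exists b, ~ P b /\ forall l, l \in L -> A l b.
Proof.
move=> [idP P1 primeP]; elim: L => [|l L IH] idA nAP; first by exists 1.
have [k kL|k kL|b [nPb Ab]] := IH.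
- by apply: idA; rewrite inE kL orbT.
- by apply: nAP; rewrite inE kL orbT.
have [a [Ala nPa]] : exists a, A l a /\ ~ P a.
  apply: contrapT => noa; apply: (nAP l); rewrite ?inE ?eqxx // => a Aa.
  by apply: contrapT => nPa; apply: noa; exists a.
exists (a * b); split=> [/primeP[] // | k]; rewrite inE => /orP[/eqP-> | kL].
  have [_ _ AM] : ideal (A l) by apply: idA; rewrite inE eqxx.
  by rewrite mulrC; apply: AM.
have [_ _ AM] : ideal (A k) by apply: idA; rewrite inE kL orbT.
by apply/AM/Ab.
Qed.

Lemma prime_avoidance (A : R -> set R) J (L : seq R) :
    ideal J -> (forall l, l \in L -> prime_ideal (A l)) ->
    (forall k l, k \in L -> l \in L -> (A k `<=` A l)%classic -> A l = A k) ->
    (forall l, l \in L -> ~ (J `<=` A l)%classic) ->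
  exists x, J x /\ forall l, l \in L -> ~ A l x.
Proof.
move=> idJ; elim: L => [|l L IH] primeA incomp nJA; first by exists 0; case: idJ.
have primeAl : prime_ideal (A l) by apply: primeA; rewrite inE eqxx.
have [k kL|k k' kL k'L|k kL|x [Jx nAx]] := IH.
- by apply: primeA; rewrite inE kL orbT.
- by apply: incomp; rewrite inE ?kL ?k'L orbT.
- by apply: nJA; rewrite inE kL orbT.
have [Alx|nAlx] := pselect (A l x); last first.
  by exists x; split=> // k; rewrite inE => /orP[/eqP-> // | /nAx].
have [z [Jz nAz]] : exists z, J z /\ ~ A l z.
  apply: contrapT => noz; apply: (nJA l); rewrite ?inE ?eqxx // => a Ja.
  by apply: contrapT => na; apply: noz; exists a.
have [||b [nAb Ab]] := prime_not_sub_inter (A := A) (L := L) primeAl.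
- by move=> k kL; have [] : prime_ideal (A k) by apply: primeA; rewrite inE kL orbT.
- move=> k kL /incomp e; apply: (nAx k kL); rewrite -e ?inE ?eqxx ?kL ?orbT //.
have [idAl _ primAl] := primeAl; have [_ JD JM] := idJ.
(* x lies in A l and outside the others, z * b the other way round. *)
exists (x + b * z); split=> [|k]; first by apply/JD/JM.
rewrite inE => /orP[/eqP-> | kL] Axz.
  have : A l (b * z) by rewrite -(addKr x (b * z)) addrC; apply: idealB.
  by move=> /primAl[].
have [[_ _ AM] _ _] : prime_ideal (A k) by apply: primeA; rewrite inE kL orbT.
apply: (nAx k kL); rewrite -(addrK (b * z) x); apply: idealB => //.
  by have [] : prime_ideal (A k) by apply: primeA; rewrite inE kL orbT.
by rewrite mulrC; apply/AM/Ab.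
Qed.

(** Zero divisors modulo I lie in annihilators that are maximal among those of
    elements outside I; these are prime and finite in number, so one of them
    contains J by prime avoidance. *)
Lemma common_annihilator I J : ideal I -> ideal J ->
    (forall x, J x -> exists a, ~ I a /\ I (x * a)) ->
  exists y, ~ I y /\ forall x, J x -> I (x * y).
Proof.
move=> idI idJ zdJ; have [I0 ID IM] := idI.
pose A y : set R := [set r | I (r * y)]%classic.
have idA y : ideal (A y).
  split=> [|a b|r a]; rewrite /A /=.
  - by rewrite mul0r.
  - by rewrite mulrDl; apply: ID.
  - by rewrite -mulrA; apply: IM.
pose maxA y := ~ I y /\ forall z, ~ I z -> (A y `<=` A z)%classic -> A z = A y.
have above a : ~ I a -> exists y, maxA y /\ (A a `<=` A y)%classic.
  move=> nIa.
  have [||_ [[y [nIy ->]] aJ Jmax]] :=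
    @ideal_maximal (fun K => exists y, ~ I y /\ K = A y) (A a).
  - by move=> _ [y [_ ->]].
  - by exists a.
  by exists y; split=> //; split=> // z nIz; apply: Jmax; exists z.
have primeA y : maxA y -> prime_ideal (A y).
  move=> [nIy ymax]; split=> // [|a b]; first by rewrite /A /= mul1r.
  move=> Iaby; have [|nIby] := pselect (A y b); [by right | left].
  rewrite -(ymax (b * y)) // /A /= ?mulrA // => r Iry.
  by rewrite /= mulrCA; apply: IM.
(* Finitely many elements with maximal annihilator generate, modulo I, all the
   others, and so every maximal annihilator contains one of theirs. *)
pose gen L : set R := [set x | exists z, I z /\ ideal_gen L (x - z)]%classic.
have idgen L : ideal (gen L).
  have [L0 LD LM] := ideal_ideal_gen L.
  split=> [|a b [z [Iz az]] [w [Iw bw]]|r a [z [Iz az]]].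
  - by exists 0; rewrite subr0.
  - by exists (z + w); rewrite opprD addrACA; split; [apply: ID | apply: LD].
  - by exists (r * z); rewrite -mulrBr; split; [apply: IM | apply: LM].
have [||_ [[L [Lmax ->]] _ genmax]] := @ideal_maximal
    (fun K => exists L, (forall l, l \in L -> maxA l) /\ K = gen L) (gen [::]).
- by move=> _ [L [_ ->]].
- by exists [::].
have inL y : maxA y -> exists l, l \in L /\ A y = A l.
  move=> ymax; apply: contrapT => nol.
  have geny : gen L y.
    rewrite -(genmax (gen (rcons L y))).
    - exists 0; split=> //; rewrite subr0; apply: mem_ideal_gen.
      by rewrite mem_rcons inE eqxx.
    - exists (rcons L y); split=> // l; rewrite mem_rcons inE.
      by move=> /orP[/eqP-> | /Lmax].
    - move=> x [z [Iz xz]]; exists z; split=> //; apply/ideal_gen_rcons.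
      by exists 0; rewrite mul0r subr0.
  have [l lL|l lL ly|b [nAb Ab]] := @prime_not_sub_inter A (A y) L (primeA _ ymax).
  - exact: idA.
  - apply: nol; exists l; split=> //.
    by apply: (Lmax l lL).2 => //; case: ymax.
  apply: nAb; have [z [Iz yz]] := geny; rewrite /A /= -(subrK z y) mulrDr.
  apply: (ID); last exact: IM.
  move: yz => [c ->]; rewrite mulr_sumr; apply: (big_ind I) => // i _.
  by rewrite mulrCA; apply/IM/Ab/mem_nth.
apply: contrapT => noy.
have [||l lL JA|x [Jx nAx]] := @prime_avoidance A J L idJ.
- by move=> l /Lmax/primeA.
- move=> k l kL lL; apply: (Lmax k kL).2; exact: (Lmax l lL).1.
- by apply: noy; exists l; split=> //; case: (Lmax l lL).
have [a [nIa Ixa]] := zdJ x Jx.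
have [y [ymax ay]] := above a nIa; have [l [lL yl]] := inL y ymax.
by apply: (nAx l lL); rewrite -yl; apply: ay.
Qed.

Variable m : set R.
Hypothesis R_local : is_local m.

Lemma proper_sub_max J : ideal J -> ~ J 1 -> (J `<=` m)%classic.
Proof.
move=> idJ nJ1.
have [||K [[idK nK1] JK Kmax]] :=
    @ideal_maximal (fun K => ideal K /\ ~ K 1) J; [by move=> K [] | by [] |].
suff <- : K = m by [].
by apply: R_local.2; split=> // K' idK' nK'1; apply: Kmax.
Qed.

(** Modulo a regular sequence of maximal length the maximal ideal consists of
    zero divisors, hence is the annihilator of a single element. *)
Lemma depth_socle t : has_depth m t ->
  exists s y, [/\ size s = t, regular_seq s, ~ ideal_gen s y
                & forall x, m x -> ideal_gen s (x * y)].
Proof.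
move=> [[s [sm sreg st]] smax].
have [[[idm nm1 _] _] [regs ns1]] := (R_local, sreg).
have [x mx|y [nsy ys]] := common_annihilator (ideal_ideal_gen s) idm.
  apply: contrapT => noa.
  have := smax (rcons s x); rewrite size_rcons st ltnn => ltt.
  suff: false by []; apply: ltt => [y|].
    by rewrite mem_rcons inE => /orP[/eqP-> | /sm].
  have xs_m : forall b, b \in rcons s x -> m b.
    by move=> b; rewrite mem_rcons inE => /orP[/eqP-> | /sm].
  split=> [i a|/(ideal_gen_sub idm xs_m) //]; rewrite size_rcons ltnS leq_eqVlt.
  case/orP=> [/eqP-> | ilt].
    rewrite nth_rcons ltnn eqxx -cats1 take_size_cat // => sxa.
    by apply: contrapT => nsa; apply: noa; exists a.
  rewrite nth_rcons ilt -cats1 takel_cat ?(ltnW ilt) //; exact: regs.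
by exists s, y.
Qed.

(** * Detecting modules by Ext in degrees up to the depth *)

(** Drop generators as long as the remaining ones suffice: the first one that
    cannot be dropped generates E modulo the span S of the others. *)
Lemma cyclic_quotient (E : lmodType R) (e : E) : fin_gen E -> e <> 0 ->
  exists (S : submodule E) (x : E), ~ S x /\ forall z, exists a, S (z - a *: x).
Proof.
move=> /fin_genP[s sE] e0; elim: s sE => [|y s IH] sE; first by have := sE e.
have [sy|nsy] := pselect (in_span s y).
  apply: IH => x; have [a sx] := sE x.
  by rewrite -(subrK (a *: y) x); apply: spanD => //; apply: spanZ.
unshelve eexists (@Submodule R E (in_span s) _ _ _), y; last by [].
- exact: span0.
- exact: spanD.
- exact: spanZ.
Qed.

Definition ideal_smod s : submodule R^o.
Proof.
by exists (ideal_gen s : R^o -> Prop); have [] := ideal_ideal_gen s.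
Defined.

(** A nonzero finitely generated module has a nonzero cyclic quotient R/J, and
    J annihilates y because it lies in m. *)
Lemma nonzero_functional (E N : lmodType R) (e : E) (y : N) :
    fin_gen E -> e <> 0 -> y <> 0 -> (forall x, m x -> x *: y = 0) ->
  exists (h : {linear E -> N}) x, h x <> 0.
Proof.
move=> fgE e0 y0 my0; have [S [x [nSx /choice[c cP]]]] := cyclic_quotient fgE e0.
have Jm r : S (r *: x) -> m r.
  have idJ : ideal [set r | S (r *: x)]%classic.
    split=> [|a b|a b] /=; first by rewrite scale0r; apply: smod0.
      by rewrite scalerDl; apply: smodD.
    by rewrite -scalerA; apply: smodZ.
  by apply: (proper_sub_max idJ); rewrite /= scale1r.
have cE z a : S (z - a *: x) -> c z *: y = a *: y.
  move=> Sa; apply/eqP; rewrite -subr_eq0 -scalerBl; apply/eqP/my0/Jm.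
  by rewrite scalerBl -(subrKA z); apply: smodD => //; apply/smodC/cP.
have [|h hE] := @linear_fun R E N (fun z => c z *: y).
  move=> a z w; rewrite scalerA -scalerDl; apply: cE.
  by rewrite scalerDl opprD addrACA -scalerA -scalerBr; apply/smodD/cP/smodZ/cP.
exists h, x; rewrite hE (cE x 1) ?scale1r // subrr; exact: smod0.
Qed.

(** The exact sequence Hom(Y, N) -> Hom(Y, N'') -> Ext^1(Y, N'). *)
Lemma lift_of_Ext1 (Y N' N N'' : lmodType R) (f : {linear N' -> N})
    (g : {linear N -> N''}) (h : {linear Y -> N''}) :
    short_exact f g -> Ext_eq0 1 Y N' ->
  exists k : {linear Y -> N}, forall x, g (k x) = h x.
Proof.
move=> [f_inj fg g_surj] [P]; move/(hom_exactP _ (@res_exact _ _ P 0)) => exN'.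
have [l lE] :=
  proj_lift_surj (h \o res_aug P : {linear _ -> _}) (@res_proj _ _ P 0) g_surj.
have [x|e eE] := factor_inj (f := l \o res_diff P 0 : {linear _ -> _}) f_inj.
  by apply/fg; rewrite /= lE /= (exact_comp0 x (@res_exact0 _ _ P)) linear0.
have [x|k kE] := exN' e.
  by apply: f_inj; rewrite eE /= (exact_comp0 x (@res_exact _ _ P 0)) !linear0.
have [x|r rE] :=
    factor_surj (f := l \- (f \o k) : {linear _ -> _}) (res_surj P).
  by move=> /(@res_exact0 _ _ P)[z <-]; rewrite /= kE eE subrr.
exists r => y; have [x <-] := res_surj P y.
by rewrite rE /= linearB (exact_comp0 (k x) fg) subr0 lE.
Qed.

(** Modulo one more element of the sequence one degree of Ext is lost, by the
    sequence 0 -> N -> N -> N' -> 0 given by that element. *)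
Lemma regular_seq_reduction s (Y Z : lmodType R) : regular_seq s ->
    (forall i, (i < size s)%N -> Ext_eq0 i.+1 Y R^o) ->
    (forall i, (i <= size s)%N -> Ext_eq0 i.+1 Z R^o) ->
  exists (N : lmodType R) (q : {linear R^o -> N}),
    [/\ surjective q, forall a, q a = 0 <-> ideal_gen s a, Ext_eq0 1 Z N
      & forall h : {linear Y -> N}, exists k : {linear Y -> R^o},
          forall x, q (k x) = h x].
Proof.
move=> [reg _] ExtY ExtZ.
suff /(_ (size s) (leqnn _)) [N [q [q_surj kerq _ ExtZN lift]]] :
    forall j, (j <= size s)%N -> exists (N : lmodType R) (q : {linear R^o -> N}),
    [/\ surjective q, forall a, q a = 0 <-> ideal_gen (take j s) a,
        forall i, (i + j < size s)%N -> Ext_eq0 i.+1 Y N,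
        forall i, (i + j <= size s)%N -> Ext_eq0 i.+1 Z N
      & forall h : {linear Y -> N}, exists k : {linear Y -> R^o},
          forall x, q (k x) = h x].
  exists N, q; rewrite take_size in kerq; split=> //.
  by apply: ExtZN; rewrite add0n.
elim=> [|j IH] js.
  exists R^o, (idfun : {linear _ -> _}); rewrite take0; split.
  - by move=> x; exists x.
  - move=> a /=; split=> [-> |[c ->]]; first by case: (ideal_ideal_gen [::]).
    by rewrite big_ord0.
  - by move=> i; rewrite addn0; apply: ExtY.
  - by move=> i; rewrite addn0; apply: ExtZ.
  - by move=> h; exists h.
have [N [q [q_surj kerq ExtYN ExtZN lift]]] := IH (ltnW js).
pose x := s`_j; pose q' := quot_proj (ideal_smod (take j.+1 s)).
have kerq' a : q' a = 0 <-> exists b, q (a - b * x : R^o) = 0.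
  rewrite (quot_proj_eq0 (ideal_smod _)) /= (take_nth 0) //.
  split=> [/ideal_gen_rcons[b] |[b] /kerq h]; first by exists b; apply/kerq.
  by apply/ideal_gen_rcons; exists b.
have q'_surj : surjective q' by apply: quot_proj_surj.
have [a|g gE] := factor_surj (f := q') q_surj.
  by move=> qa; apply/kerq'; exists 0; rewrite mul0r subr0.
have [|f fE] := @linear_fun R N N (fun z => x *: z).
  by move=> a z w; rewrite scalerDr !scalerA mulrC.
have ex : short_exact f g.
  split=> [z w | z | z].
  - rewrite !fE => e; apply/eqP; rewrite -subr_eq0; apply/eqP.
    have [a aE] := q_surj (z - w); rewrite -aE; apply/kerq/(reg j) => //.
    by apply/kerq; rewrite -/x -[x * a]/(x *: (a : R^o)) linearZ /= aE scalerBr e subrr.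
  - have [a <-] := q_surj z; rewrite gE; split=> [/kerq'[b]|[w]].
      rewrite linearB => /eqP; rewrite subr_eq0 => /eqP->.
      by exists (q b); rewrite fE -linearZ /= [b * x]mulrC.
    have [b <-] := q_surj w; rewrite fE -linearZ => e; apply/kerq'; exists b.
    by rewrite linearB -e [b * x]mulrC subrr.
  - by have [a <-] := q'_surj z; exists (q a).
exists (quot (ideal_smod (take j.+1 s))), q'; split=> //.
- by move=> a; apply: quot_proj_eq0.
- move=> i ij; apply: (Ext_long_exact ex); apply: ExtYN; last by rewrite addSnnS.
  by apply: ltn_trans ij; rewrite addnS.
- move=> i ij; apply: (Ext_long_exact ex); apply: ExtZN; last by rewrite addSnnS.
  by apply: leq_trans ij; rewrite addnS.
- move=> h; have [|k kE] := lift_of_Ext1 h ex; first by apply: ExtYN.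
  by have [l lE] := lift k; exists l => y; rewrite -kE -lE gE.
Qed.

(** Over the quotient of R by a maximal regular sequence, functionals on Y
    still come from R and so kill E, while functionals on E extend to Y: there
    are none but 0 on E. *)
Lemma depth_detects t (E Y Z : lmodType R) (f : {linear E -> Y})
    (g : {linear Y -> Z}) :
    has_depth m t -> fin_gen E -> short_exact f g ->
    (forall i, (i < t)%N -> Ext_eq0 i.+1 Y R^o) ->
    (forall i, (i <= t)%N -> Ext_eq0 i.+1 Z R^o) ->
    (forall (h : {linear Y -> R^o}) e, h (f e) = 0) ->
  forall e : E, e = 0.
Proof.
move=> /depth_socle[s [y [<- sreg nsy ys]]] fgE ex ExtY ExtZ fE0 e.
have [N [q [q_surj kerq ExtZN lift]]] := regular_seq_reduction sreg ExtY ExtZ.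
apply: contrapT => e0.
have [|x mx|h [x]] := @nonzero_functional E N e (q y) fgE e0.
- by move/kerq.
- by rewrite -linearZ; apply/kerq/ys.
have [k kE] := extension_of_Ext1 h ex ExtZN; have [l lE] := lift k.
by rewrite -kE -lE fE0 linear0.
Qed.

End NoetherianRing.

(** * Closure under syzygies or extensions *)

Section Closure.
Variable R : comNzRingType.
Implicit Types M L X Y Z : lmodType R.
Hypothesis R_noetherian : noetherian R.

Local Notation dmap d := (@hom_precomp R _ _ d R^o).

Lemma coimage_short_exact (U V : lmodType R) (f : {linear U -> V}) :
  exists iota : {linear quot (kernel_smod f) -> V},
    short_exact iota (quot_proj (image_smod f)).
Proof.
have [x|iota iotaE] :=
    factor_surj (f := f) (@quot_proj_surj _ _ (kernel_smod f)).
  by move/(quot_proj_eq0 (kernel_smod f)).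
exists iota; split=> [z w | y |]; last exact: quot_proj_surj.
  have [x <-] := quot_proj_surj z; have [x' <-] := quot_proj_surj w.
  rewrite !iotaE => e; apply/eqP; rewrite -subr_eq0 -linearB; apply/eqP.
  by apply/(quot_proj_eq0 (kernel_smod f)); rewrite /= linearB e subrr.
rewrite quot_proj_eq0; split=> [[x <-]|[z <-]].
  by exists (quot_proj _ x); rewrite iotaE.
by have [x <-] := quot_proj_surj z; exists x; rewrite iotaE.
Qed.

Section UniversalExtension.
Variables (F2 F1 F0 M : lmodType R).
Variables (d1 : {linear F2 -> F1}) (d0 : {linear F1 -> F0}).
Variable p : {linear F0 -> M}.
Hypotheses (fgF1 : fg_proj F1) (fgF0 : fg_proj F0).
Hypotheses (exd : exact_at d1 d0) (exp : exact_at d0 p) (p_surj : surjective p).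

(** Generators of the 1-cocycles of Hom(F, R) define an extension X of M by a
    free module in which all of Ext^1(M, R) dies; the dual of its
    presentation has all the cocycles as its image. *)
Lemma universal_extension :
  exists (L X : lmodType R) (f : {linear L -> X}) (g : {linear X -> M}),
    [/\ fg_proj L, fin_gen X, short_exact f g
      & is_transpose X (quot (kernel_smod (dmap d1)))].
Proof.
have fgB := fin_gen_kernel R_noetherian (dmap d1) (fg_proj_dual fgF1).1.
have [k [c c_surj]] := fin_gen_cover fgB.
pose phi : {linear 'rV[R]_k -> dual F1} := kernel_incl (dmap d1) \o c.
pose L := dual 'rV[R]_k.
have fgL : fg_proj L by apply/fg_proj_dual/free_fg_proj.
have phid1 a x : phi a (d1 x) = 0.
  exact: (hom_app x (kernel_inclK (c a))).
have [|u uE] :=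
    @linear_fun R F1 (L * F0)%type (fun x => (dmap phi (eval_map x), d0 x)).
  by move=> a x y; rewrite !linearP.
pose X : lmodType R := quot (image_smod u).
have [pi [pi_surj expi]] : exists pi : {linear (L * F0)%type -> X},
    surjective pi /\ exact_at u pi.
  by exists (quot_proj _); split; [exact: quot_proj_surj | exact: coker_exact].
have [|i iE] := @linear_fun R L (L * F0)%type (fun l => (l, 0)).
  by move=> a x y; congr (_, _); rewrite /= scaler0 addr0.
have [|p' p'E] := @linear_fun R (L * F0)%type M (fun z => p z.2).
  by move=> a x y; rewrite linearP.
have [z|g gE] := factor_surj (f := p') pi_surj.
  by move=> /expi[x <-]; rewrite p'E uE /= (exact_comp0 x exp).
exists L, X, (pi \o i : {linear _ -> _}), g; split=> //.
- exact: fin_gen_surj pi_surj (fg_proj_pair fgL fgF0).1.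
- split=> [l l' | z | y].
  + move=> /= e; apply/eqP; rewrite -subr_eq0; apply/eqP.
    have /expi[x] : pi (i (l - l')) = 0 by rewrite !linearB e subrr.
    rewrite uE iE => e1; have /exd[y yE] : d0 x = 0 := congr1 snd e1.
    rewrite -[LHS](congr1 fst e1) -yE /=; apply: hom_ext => a; exact: phid1.
  + have [[l a] <-] := pi_surj z; rewrite gE p'E /=; split=> [/exp[x xE]|[l' e]].
      exists (l - dmap phi (eval_map x)) => /=.
      apply/eqP; rewrite -subr_eq0 -linearB; apply/eqP/expi; exists (- x).
      rewrite linearN uE iE; congr (_, _) => /=; last by rewrite sub0r xE.
      by rewrite addrAC subrr add0r.
    rewrite -[p a]/(p (l, a).2) -p'E -gE -e /= gE p'E iE.
    exact: linear0.
  + have [a <-] := p_surj y; exists (pi (0, a)).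
    by rewrite gE p'E.
exists F1, (L * F0)%type, u, pi, (quot_proj (kernel_smod (dmap d1))).
split=> //; last exact: quot_proj_surj; first exact: fg_proj_pair.
move=> psi; rewrite quot_proj_eq0 /=; split=> [/kernel_lift[b bE] | [theta <-]].
  have [a aE] := c_surj b.
  have [|theta thetaE] := @linear_fun R (L * F0)%type R^o (fun z => z.1 a).
    by [].
  exists (theta : dual _); apply: hom_ext => x; rewrite /= thetaE uE.
  by rewrite -[LHS]/(kernel_incl (dmap d1) (c a) x) aE bE.
apply: hom_ext => x /=; rewrite uE (exact_comp0 x exd).
rewrite (_ : dmap phi _ = 0); first exact: linear0.
by apply: hom_ext => a /=; apply: phid1.
Qed.

End UniversalExtension.

Lemma TF_projective n L : fg_proj L -> TF n L.
Proof.
move=> fgL; split; first exact: fgL.1.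
exists (dual 'rV[R]_0); last first.
  move=> [|i] // _ _; apply: (Ext_projective R_noetherian).
  exact/fg_proj_dual/free_fg_proj.
exists 'rV[R]_0, L, \0, idfun, idfun; split=> //.
- exact: free_fg_proj.
- split; last by move=> x; exists x.
  by move=> x /=; split=> [->|[_ <-] //]; exists 0.
- move=> psi /=; split=> [-> | _]; first by exists 0; apply: hom_ext.
  by apply: hom_ext => x; rewrite (_ : x = 0) ?linear0 //; apply/rowP; case.
- by move=> psi; exists psi.
Qed.

(** With Ext^1(M, R) = 0 the transpose of M is a first syzygy of the transpose
    of the syzygy of M, whose first Ext vanishes too. *)
Lemma TF_syzygy n M (fgM : fin_gen M) :
    let G := free_resolution R_noetherian fgM in
    TF n M -> hom_exact (res_diff G 1) (res_diff G 0) R^o ->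
  TF n (kernel (free_cover M)).
Proof.
move=> G TFM exG.
have fgK := fin_gen_syzygy R_noetherian M.
have KW := free_res_transpose R_noetherian fgK.
have MY := free_res_transpose R_noetherian fgM.
have ExtY := TF_transpose R_noetherian TFM MY.
have resY := resolvable_fg R_noetherian (fin_gen_transpose MY).
have fgG j : fg_proj (res_obj G j) by apply: free_res_fg_proj.
split=> //; eexists; first exact: KW.
move=> [|[|i]] // _ ilen.
  exact: (Ext1_cosyzygy (fgG _) (fgG _) (fgG _) (@res_exact _ _ G 0)
    (coker_exact _) (@quot_proj_surj _ _ _) (coker_exact _)
    (@quot_proj_surj _ _ _) exG resY).
apply/(Ext_cosyzygy (fgG _) (fgG _) (fgG _) (@res_exact _ _ G 0)
    (coker_exact _) (@quot_proj_surj _ _ _) (coker_exact _)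
    (@quot_proj_surj _ _ _) exG resY).
by apply: ExtY => //; apply: le_trans ilen; rewrite lez_nat.
Qed.

(** Once Ext^1(M, R) vanishes on TF_n, that class is closed under syzygies, so
    that all Ext^i(M, R) vanish; the transpose of M is then n-torsionfree as
    well, and the same applies to it. *)
Lemma TF_totally_reflexive n :
    (forall M, TF n M -> Ext_eq0 1 M R^o) ->
  forall M, TF n M -> totally_reflexive M.
Proof.
move=> Ext1.
have ExtTF i M : TF n M -> Ext_eq0 i.+1 M R^o.
  elim: i M => [|i IH] M TFM; first exact: Ext1.
  have fgM := TFM.1; apply/(Ext_syzygy R_noetherian _ _ fgM)/IH.
  apply: (TF_syzygy (fgM := fgM)) => //.
  by apply/Ext_eq0P/Ext1.
move=> M TFM; have [fgM [T MT _]] := TFM.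
have TFT : TF n T.
  split; first exact: fin_gen_transpose MT.
  by exists M; [exact: transpose_sym | move=> [|i] // _ _; apply: ExtTF].
split=> // [[|i] // _|]; first exact: ExtTF.
by exists T => // -[|i] // _; apply: ExtTF.
Qed.

Variables (m : set R) (t : nat).
Hypotheses (R_local : is_local m) (R_depth : has_depth m t).

(** Ext^1(M, R) is the kernel of the map from the transpose Y to the image Z of
    the next dual differential, and functionals on Y kill it. *)
Lemma Ext1_of_depth n M (fgM : fin_gen M) :
    let G := free_resolution R_noetherian fgM in
    TF n M -> t%:Z <= n ->
    Ext_vanish (t%:Z + 1) (quot (kernel_smod (dmap (res_diff G 1)))) ->
  Ext_eq0 1 M R^o.
Proof.
move=> G TFM len ExtZ; apply/(Ext_eq0P G).
have MY := free_res_transpose R_noetherian fgM.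
have ExtY := TF_transpose R_noetherian TFM MY.
have fgG j : fg_proj (res_obj G j) by apply: free_res_fg_proj.
pose q0 := quot_proj (image_smod (dmap (res_diff G 0))).
pose z := quot_proj (kernel_smod (dmap (res_diff G 1))).
have ker_z psi : z psi = 0 <-> dmap (res_diff G 1) psi = 0.
  exact: quot_proj_eq0.
have d1d0 psi : dmap (res_diff G 1) (dmap (res_diff G 0) psi) = 0.
  apply: hom_ext => x; transitivity (psi (res_diff G 0 (res_diff G 1 x))) => //.
  by rewrite (exact_comp0 x (@res_exact _ _ G 0)) linear0.
have exq0 : exact_at (dmap (res_diff G 0)) q0 by apply: coker_exact.
have [psi|g gE] := factor_surj (f := z) (@quot_proj_surj _ _ _ : surjective q0).
  by move=> /exq0[phi <-]; apply/ker_z/d1d0.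
have fgY := fin_gen_transpose MY.
have ker_g0 : forall e : kernel g, e = 0.
  apply: (depth_detects R_noetherian R_local R_depth _
            (f := kernel_incl g) (g := g)).
  - exact: fin_gen_kernel.
  - split; [exact: kernel_incl_inj | exact: kernel_exact | move=> y].
    have [psi <-] := (@quot_proj_surj _ _ _ : surjective z) y.
    by exists (q0 psi).
  - by move=> i it; apply: ExtY => //; apply: le_trans len; rewrite lez_nat.
  - by move=> i it; apply: ExtZ => //; rewrite -PoszD lez_nat addn1.
  move=> h e; have [y yE] := transpose_functional (fgG _) (fgG _)
    (@res_exact _ _ G 0) exq0 h.
  have [psi psiE] := (@quot_proj_surj _ _ _ : surjective q0) (kernel_incl g e).
  have d1psi : dmap (res_diff G 1) psi = 0.
    by apply/ker_z; rewrite -gE psiE kernel_inclK.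
  by rewrite -psiE yE; apply: (hom_app y d1psi).
apply/(hom_exactP _ (@res_exact _ _ G 0)) => psi; split=> [d1psi|[phi <-]];
  last exact: d1d0.
apply/exq0; have /kernel_lift[e <-] : g (q0 psi) = 0 by rewrite gE; apply/ker_z.
by rewrite (ker_g0 e) linear0.
Qed.

Lemma TF_syzygies_totally_reflexive n :
    t%:Z + 2 <= n -> closed_under_syzygies (@TF R n) ->
  forall M, TF n M -> totally_reflexive M.
Proof.
move=> len closed; apply: TF_totally_reflexive => M TFM; have fgM := TFM.1.
apply: (Ext1_of_depth (fgM := fgM) TFM).
  by apply: le_trans len; rewrite lerDl.
have TFK : TF n (kernel (free_cover M)).
  apply: closed TFM _.
  exists 'rV[R]_(cover_rank M), (kernel_incl (free_cover M)), (free_cover M).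
  split.
  - exact: free_fin_gen.
  - exact: free_projective.
  - exact: cover_short_exact.
have fgK := fin_gen_syzygy R_noetherian M.
have ExtW := TF_transpose R_noetherian TFK (free_res_transpose R_noetherian fgK).
set d := res_diff _ 1; have [iota ex] := coimage_short_exact (dmap d).
have fgD : fg_proj (dual (res_obj (free_resolution R_noetherian fgM) 2)).
  exact/fg_proj_dual/free_res_fg_proj.
have [iota_inj _ _] := ex.
have resZ := resolvable_fg R_noetherian (fin_gen_inj R_noetherian iota_inj fgD.1).
move=> [|i] // _ ilet; apply/(Ext_shift _ _ resZ fgD.2 ex)/ExtW => //.
apply: le_trans len; move: ilet; rewrite -!PoszD !lez_nat addn1 addn2.
by rewrite !ltnS.
Qed.

Lemma TF_extensions_totally_reflexive n :
    t%:Z + 1 <= n -> closed_under_extensions (@TF R n) ->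
  forall M, TF n M -> totally_reflexive M.
Proof.
move=> len closed; apply: TF_totally_reflexive => M TFM; have fgM := TFM.1.
pose G := free_resolution R_noetherian fgM.
apply: (Ext1_of_depth (fgM := fgM) TFM).
  by apply: le_trans len; rewrite lerDl.
have fgG j : fg_proj (res_obj G j) by apply: free_res_fg_proj.
have [L [X [f [g [fgL fgX ex XZ]]]]] := universal_extension (fgG 1%N) (fgG 0%N)
  (@res_exact _ _ G 0) (@res_exact0 _ _ G) (res_surj G).
have TFX := closed _ _ _ f g fgL.1 fgX fgM ex (TF_projective n fgL) TFM.
move=> i i1 ilet; apply: (TF_transpose R_noetherian TFX XZ) => //.
exact: le_trans ilet len.
Qed.

End Closure.

Theorem theorem1p3 (R : comNzRingType) (m : set R) (t : nat) (n : int)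
    (R_noetherian : noetherian R) (R_local : is_local m)
    (R_depth : has_depth m t)
    (H : [\/ t%:Z + 2 <= n /\ closed_under_syzygies (@TF R n),
             t%:Z + 1 <= n /\ closed_under_extensions (@TF R n)
           | 1 <= n /\ forall M : lmodType R, TF n M <-> TF (n + 1) M]) :
  forall M : lmodType R, TF n M <-> totally_reflexive M.
Proof.
move=> M; split=> [|[fgM _ [T MT ExtT]]]; last first.
  by split=> //; exists T => // i i1 _; apply: ExtT.
case: H => [[len closed]|[len closed]|[n_ge1 stable]].
- exact: (TF_syzygies_totally_reflexive R_noetherian R_local R_depth).
- exact: (TF_extensions_totally_reflexive R_noetherian R_local R_depth).
case: n n_ge1 stable => // n n_ge1 stable.
apply: (TF_stable_totally_reflexive R_noetherian) => // N /stable.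
by rewrite -PoszD addn1.
Qed.
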